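(* Let $p\ge1$ and let $U^{p}(\Gamma)$ and $U^{p+1}(\Gamma)$ be $H^1$-conforming polynomial bases on the reference triangle $\Gamma$ of degrees $p$ and $p+1$. Let $$\boldsymbol\phi^I_1=\begin{bmatrix}1-\xi\\-\eta\end{bmatrix},\qquad \boldsymbol\phi^I_2=\begin{bmatrix}\xi\\ \eta-1\end{bmatrix},\qquad \boldsymbol\phi^I_3=\begin{bmatrix}-\xi\\-\eta\end{bmatrix},$$ let $\mathcal{RT}^0$ be spanned by $\boldsymbol\phi^I_1,\boldsymbol\phi^I_2,\boldsymbol\phi^I_3$, and let $$\mathcal T_1=\{-\boldsymbol\phi^I_3\},\quad \mathcal T_2=\{\boldsymbol\phi^I_2\},\quad \mathcal T_{12}=\{\boldsymbol\phi^I_2-\boldsymbol\phi^I_3\},\quad \mathcal T_{13}=\{-\boldsymbol\phi^I_1-\boldsymbol\phi^I_3\},$$ $$\mathcal T_{23}=\{\boldsymbol\phi^I_2-\boldsymbol\phi^I_1\},\quad \mathcal T_{123}=\{\boldsymbol\phi^I_2-\boldsymbol\phi^I_1-\boldsymbol\phi^I_3\}.$$ Then the finite element $$\mathcal{RT}^p=\mathcal{RT}^0\oplus\Big\{\bigoplus_{j\in\mathcal J}\boldsymbol R\nabla\mathcal E_j^{p+1}\Big\}\oplus\boldsymbol R\nabla\mathcal C_{123}^{p+1}\oplus\Big\{\bigoplus_{i=1}^2\mathcal V^p_i\otimes\mathcal T_i\Big\}\oplus\Big\{\bigoplus_{j\in\mathcal J}\mathcal E^p_j\otimes\mathcal T_j\Big\}\oplus\{\mathcal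 C^p_{123}\otimes\mathcal T_{123}\},$$ with $\mathcal J=\{(1,2),(1,3),(2,3)\}$, is $H(\mathrm{div})$-conforming under contravariant Piola mappings.
   Context: $\Gamma=\{(\xi,\eta)\in[0,1]^2 \mid \xi+\eta\le 1\}$ has vertices $v_1=(0,0)$, $v_2=(0,1)$, $v_3=(1,0)$, edges $e_{12},e_{13},e_{23}$ ($e_{ij}$ joins $v_i$ and $v_j$) and cell $c_{123}$. $P^q(\Gamma)$ denotes the polynomials of total degree at most $q$. $\boldsymbol R=\begin{bmatrix}0&1\\-1&0\end{bmatrix}$, so that $\boldsymbol R\nabla n=(n_{,\eta},-n_{,\xi})^T$ on the reference triangle. $H^1$-conforming polynomial basis $U^q(\Gamma)$ ($q\ge1$): linearly independent polynomials in $P^q(\Gamma)$ with $\dim U^q(\Gamma)=\dim P^q(\Gamma)=(q+2)(q+1)/2$, each associated with one polytope: one vertex base function for each vertex ($\mathcal V^q_i$), $q-1$ edge base functions for each edge ($\mathcal E^q_j$), $(q-2)(q-1)/2$ cell base functions ($\mathcal C^q_{123}$). A vertex base function vanishes at all other vertices and on the non-neighbouring edge; an edge base function vanishes on all other edges; a cell base function vanishes on the boundary. Being $H^1$-conforming means that, after mapping to the elements of a mesh by $n\mapsto n\circ\mathbf x_e^{-1}$ and identifying corresponding base functions of shared vertices and edges, the assembled functions are continuous across element interfaces. $\mathcal S\otimes\mathcal T_\ast$ denotes all products $n\boldsymbol\ell$ with $n\in\mathcal S$, $\boldsymbol\ell\in\mathcal T_\ast$. Association: to an edge $e_{ij}$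 belong the function $\boldsymbol\phi^I_k$ with non-vanishing normal trace on $e_{ij}$ and the curls $\boldsymbol R\nabla_\xi n$, $n\in\mathcal E^{p+1}_{ij}$; all remaining base functions (the tensor products and $\boldsymbol R\nabla_\xi n$, $n\in\mathcal C^{p+1}_{123}$) belong to the cell. Meshes: $A\subset\mathbb R^2$ is decomposed into a conforming triangulation with elements $A_e=\mathbf x_e(\Gamma)$, with invertible element maps $\mathbf x_e$ (e.g. affine) with Jacobian matrix $\mathbf J_e$, chosen so that the local vertex order agrees on shared edges. The contravariant Piola transformation maps a reference field $\boldsymbol\phi$ to $\boldsymbol\varphi=\frac{1}{\det\mathbf J_e}\mathbf J_e\,\boldsymbol\phi\circ\mathbf x_e^{-1}$ (signed determinant). $H(\mathrm{div},A)=\{\mathbf u\in[L^2(A)]^2 \mid \mathrm{div}\,\mathbf u\in L^2(A)\}$. ''$H(\mathrm{div})$-conforming'' means: identifying corresponding mapped base functions of shared edges (and extending cell base functions by zero), the resulting piecewise space is a subspace of $H(\mathrm{div},A)$, equivalently the jump of the normal trace $\langle\mathbf n,\mathbf u\rangle$ vanishes on every element interface. *)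

(* Defs.v *)
From HB Require Import structures.
From mathcomp Require Import all_boot all_order all_algebra.
From mathcomp Require Import all_classical all_reals all_analysis.

Set Implicit Arguments.
Unset Strict Implicit.
Unset Printing Implicit Defensive.

Import Order.TTheory GRing.Theory Num.Theory.
Import numFieldTopology.Exports numFieldNormedType.Exports.

Local Open Scope classical_set_scope.
Local Open Scope ring_scope.

Definition dot (R : realType) (u v : R * R) : R := u.1 * v.1 + u.2 * v.2.

(** * The reference triangle

    The vertices v_1, v_2, v_3 are numbered 0, 1, 2, and the edges e_12, e_13,
    e_23 are numbered 0, 1, 2 in this order. *)

Definition Gam (R : realType) : set (R * R) :=
  [set x | [/\ 0 <= x.1, 0 <= x.2 & x.1 + x.2 <= 1]].
Arguments Gam : clear implicits.

Definition vtx (R : realType) (i : 'I_3) : R * R :=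
  tnth [tuple (0, 0); (0, 1); (1, 0)] i.

Definition edge_src (k : 'I_3) : 'I_3 :=
  let v1 := @Ordinal 3 0 isT in let v2 := @Ordinal 3 1 isT in
  tnth [tuple v1; v1; v2] k.
Definition edge_tgt (k : 'I_3) : 'I_3 :=
  let v2 := @Ordinal 3 1 isT in let v3 := @Ordinal 3 2 isT in
  tnth [tuple v2; v3; v3] k.

Definition edge_tangent (R : realType) (k : 'I_3) : R * R :=
  vtx R (edge_tgt k) - vtx R (edge_src k).

Definition edge_par (R : realType) (k : 'I_3) (t : R) : R * R :=
  vtx R (edge_src k) + t *: edge_tangent R k.

Definition edge (R : realType) (k : 'I_3) : set (R * R) :=
  @edge_par R k @` `[0, 1].

(** * Polynomials in two variables

    [n`_j`_i] is the coefficient of xi^i eta^j: the outer variable is eta. *)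

Notation bipoly R := {poly {poly R}}.

Definition ev (R : realType) (n : bipoly R) (x : R * R) : R :=
  n.[x.2%:P].[x.1].

Definition total_degree_le (R : realType) (q : nat) (n : bipoly R) : Prop :=
  forall i j : nat, (q < i + j)%N -> n`_j`_i = 0.

Definition dxi (R : realType) (n : bipoly R) : bipoly R := map_poly (@deriv R) n.
Definition deta (R : realType) (n : bipoly R) : bipoly R := n^`().

Definition Rgrad (R : realType) (n : bipoly R) (x : R * R) : R * R :=
  (ev (deta n) x, - ev (dxi n) x).

(** * Meshes *)

Definition jac_det (R : realType) (X : R * R -> R * R) (x : R * R) : R :=
  ('d X x (1, 0)).1 * ('d X x (0, 1)).2 - ('d X x (0, 1)).1 * ('d X x (1, 0)).2.

Record mesh (R : realType) := Mesh {
  elt : finType ;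
  emap : elt -> R * R -> R * R ;
  (* every element map is a C^1 diffeomorphism of Gam onto its image *)
  emap_diff : forall e x, Gam R x -> \forall y \near x, differentiable (emap e) y ;
  emap_C1 : forall e x v, Gam R x ->
    {for x, continuous (fun y => 'd (emap e) y v)} ;
  emap_inj : forall e, {in Gam R &, injective (emap e)} ;
  emap_reg : forall e x, Gam R x -> jac_det (emap e) x != 0 ;
  mesh_conforming : forall e e', e != e' ->
    [\/ emap e @` Gam R `&` emap e' @` Gam R = set0,
        exists i j, emap e @` Gam R `&` emap e' @` Gam R = [set emap e (vtx R i)]
                    /\ emap e (vtx R i) = emap e' (vtx R j)
      | exists i j, emap e @` Gam R `&` emap e' @` Gam R = emap e @` edge i
                    /\ emap e @` edge i = emap e' @` edge j] ;
  (* shared edges are parametrised alike from both sides; for affine maps this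
     says that the two local vertex orders agree on the edge *)
  mesh_order : forall e e' i j, e != e' -> emap e @` edge i = emap e' @` edge j ->
    {in `[0, 1], forall t, emap e (edge_par i t) = emap e' (edge_par j t)}
}.

Definition element (R : realType) (M : mesh R) (e : elt M) : set (R * R) :=
  emap e @` Gam R.

Definition domain (R : realType) (M : mesh R) : set (R * R) :=
  \bigcup_(e : elt M) element e.

Definition interface (R : realType) (M : mesh R)
    (e : elt M) (i : 'I_3) (e' : elt M) (j : 'I_3) : Prop :=
  e != e' /\ emap e @` edge i = emap e' @` edge j.

Definition affine_map (R : realType) (X : R * R -> R * R) : Prop :=
  exists a b c : R * R, forall x, X x = a + x.1 *: b + x.2 *: c.

Definition affine_mesh (R : realType) (M : mesh R) : Prop :=
  forall e : elt M, affine_map (emap e).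

(** * H^1-conforming polynomial bases

    The number of functions is 3 + 3 (q - 1) + (q - 2) (q - 1) / 2, that is
    (q + 1) (q + 2) / 2, which is the dimension of P^q. *)

Definition ncell (q : nat) : nat := ((q - 2) * (q - 1))./2.

Record h1_family (R : realType) (q : nat) := H1Family {
  vertf : 'I_3 -> bipoly R ;
  edgef : 'I_3 -> 'I_q.-1 -> bipoly R ;
  cellf : 'I_(ncell q) -> bipoly R
}.

Definition h1_comb (R : realType) (q : nat) (U : h1_family R q)
    (cv : 'I_3 -> R) (ce : 'I_3 -> 'I_q.-1 -> R) (cc : 'I_(ncell q) -> R) :
    bipoly R :=
  \sum_i (cv i)%:P *: vertf U i
  + \sum_j \sum_k (ce j k)%:P *: edgef U j k
  + \sum_k (cc k)%:P *: cellf U k.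

Definition h1_basis (R : realType) (q : nat) (U : h1_family R q) : Prop :=
  [/\ forall i, total_degree_le q (vertf U i),
      forall j k, total_degree_le q (edgef U j k),
      forall k, total_degree_le q (cellf U k)
    & forall cv ce cc, h1_comb U cv ce cc = 0 ->
        [/\ forall i, cv i = 0, forall j k, ce j k = 0 & forall k, cc k = 0]].

Definition h1_polytopal (R : realType) (q : nat) (U : h1_family R q) : Prop :=
  [/\ forall i j, j != i -> ev (vertf U i) (vtx R j) = 0,
      forall i j x, i != edge_src j -> i != edge_tgt j -> edge j x ->
        ev (vertf U i) x = 0,
      forall j k l x, l != j -> edge l x -> ev (edgef U j k) x = 0
    & forall k l x, edge l x -> ev (cellf U k) x = 0].

(* A linear combination of assembled base functions is given by local
   coefficients that agree on every shared vertex and shared edge. *)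
Definition h1_compatible (R : realType) (M : mesh R) (q : nat)
    (cv : elt M -> 'I_3 -> R) (ce : elt M -> 'I_3 -> 'I_q.-1 -> R) : Prop :=
  (forall e e' i j, emap e (vtx R i) = emap e' (vtx R j) -> cv e i = cv e' j)
  /\ (forall e e' i j, interface e i e' j -> ce e i = ce e' j).

(* The assembled function is n \o x_e^-1 on the element A_e. *)
Definition h1_continuous (R : realType) (q : nat) (U : h1_family R q) : Prop :=
  forall (M : mesh R) (cv : elt M -> 'I_3 -> R)
    (ce : elt M -> 'I_3 -> 'I_q.-1 -> R) (cc : elt M -> 'I_(ncell q) -> R),
  h1_compatible cv ce ->
  forall e i e' j, interface e i e' j ->
  {in `[0, 1], forall t : R,
     ev (h1_comb U (cv e) (ce e) (cc e)) (edge_par i t)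
     = ev (h1_comb U (cv e') (ce e') (cc e')) (edge_par j t)}.

Definition h1_conforming_basis (R : realType) (q : nat) (U : h1_family R q) :
    Prop :=
  [/\ h1_basis U, h1_polytopal U & h1_continuous U].

(** * The space H(div) *)

Definition leb2 (R : realType) :=
  ((@lebesgue_measure R) \x (@lebesgue_measure R))%E.
Arguments leb2 : clear implicits.

Definition L2 (R : realType) (A : set (R * R)) (f : R * R -> R) : Prop :=
  f \_ A \in Lfun (leb2 R) 2%:E.

(* all iterated directional derivatives exist and are differentiable *)
Definition smooth (R : realType) (psi : R * R -> R) : Prop :=
  forall (s : seq (R * R)) (x : R * R),
    differentiable (foldr (fun v f => 'D_v f) psi s) x.

Definition test_function (R : realType) (A : set (R * R)) (psi : R * R -> R) :
    Prop :=
  [/\ smooth psi, compact (closure [set x | psi x != 0])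
    & closure [set x | psi x != 0] `<=` A^°].

Definition grad (R : realType) (psi : R * R -> R) (x : R * R) : R * R :=
  ('D_(1, 0) psi x, 'D_(0, 1) psi x).

Definition weak_div (R : realType) (A : set (R * R)) (u : R * R -> R * R)
    (g : R * R -> R) : Prop :=
  forall psi, test_function A psi ->
    \int[leb2 R]_(x in A) dot (u x) (grad psi x)
    = - \int[leb2 R]_(x in A) (g x * psi x).

Definition Hdiv (R : realType) (A : set (R * R)) (u : R * R -> R * R) : Prop :=
  [/\ L2 A (fst \o u), L2 A (snd \o u) & exists2 g, L2 A g & weak_div A u g].

(** * Vector-valued finite elements and H(div)-conformity *)

(* Every edge carries base functions indexed by [eidx] (corresponding base
   functions of different edges have the same index), and the cell carries base
   functions indexed by [cidx]. *)
Record vector_fe (R : realType) := VectorFE {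
  eidx : finType ;
  cidx : finType ;
  vedgef : 'I_3 -> eidx -> R * R -> R * R ;
  vcellf : cidx -> R * R -> R * R
}.

Definition v_comb (R : realType) (F : vector_fe R)
    (ce : 'I_3 -> eidx F -> R) (cc : cidx F -> R) (x : R * R) : R * R :=
  \sum_j \sum_k ce j k *: vedgef j k x + \sum_k cc k *: vcellf k x.

(* value at the point [X x] of the contravariant Piola transform of [phi] *)
Definition piola (R : realType) (X phi : R * R -> R * R) (x : R * R) : R * R :=
  (jac_det X x)^-1 *: 'd X x (phi x).

Definition v_compatible (R : realType) (F : vector_fe R) (M : mesh R)
    (ce : elt M -> 'I_3 -> eidx F -> R) : Prop :=
  forall e e' i j, interface e i e' j -> ce e i = ce e' j.

(* The assembled field: on the interior of each element it is the mapped local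
   field; on the skeleton, a null set, it is set to 0. *)
Definition v_assembled (R : realType) (F : vector_fe R) (M : mesh R)
    (ce : elt M -> 'I_3 -> eidx F -> R) (cc : elt M -> cidx F -> R) :
    R * R -> R * R :=
  fun y => \sum_(e : elt M)
    ((piola (emap e) (v_comb (ce e) (cc e)) \o 'pinv_(fun=> 0) (Gam R) (emap e))
       \_ (emap e @` (Gam R)^°)) y.

(* The one-sided normal traces agree: the vectors [n] range over all normals of
   the interface, the tangent of which is the image of the reference tangent. *)
Definition no_normal_jump (R : realType) (F : vector_fe R) (M : mesh R)
    (ce : elt M -> 'I_3 -> eidx F -> R) (cc : elt M -> cidx F -> R) : Prop :=
  forall e i e' j, interface e i e' j ->
  {in `[0, 1], forall (t : R) (n : R * R),
     dot n ('d (emap e) (edge_par i t) (edge_tangent R i)) = 0 ->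
     dot n (piola (emap e) (v_comb (ce e) (cc e)) (edge_par i t))
     = dot n (piola (emap e') (v_comb (ce e') (cc e')) (edge_par j t))}.

(* The jump of the normal trace vanishes for arbitrary element maps, and the
   assembled space lies in H(div, A) on every triangulation by affine maps. *)
Definition Hdiv_conforming (R : realType) (F : vector_fe R) : Prop :=
  forall (M : mesh R) (ce : elt M -> 'I_3 -> eidx F -> R)
    (cc : elt M -> cidx F -> R),
  v_compatible ce ->
  no_normal_jump ce cc
  /\ (affine_mesh M -> Hdiv (domain M) (v_assembled ce cc)).

(** * The element RT^p

    The element is the family of its base functions. This family can be
    linearly dependent: for p = 2 and the quadratic Lagrange basis, with
    barycentric coordinates L1, L2, L3,
    L1 (2 L1 - 1) T_1 + L1 L2 T_12 + L1 L3 T_13 = 0. *)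

Definition phi1 (R : realType) : R * R -> R * R := fun x => (1 - x.1, - x.2).
Definition phi2 (R : realType) : R * R -> R * R := fun x => (x.1, x.2 - 1).
Definition phi3 (R : realType) : R * R -> R * R := fun x => (- x.1, - x.2).

(* phi1, phi2, phi3 have non-vanishing normal trace on e_12, e_13, e_23 only *)
Definition phiI (R : realType) (k : 'I_3) : R * R -> R * R :=
  tnth [tuple @phi1 R; @phi2 R; @phi3 R] k.

Definition T_vert (R : realType) (i : 'I_2) : R * R -> R * R :=
  tnth [tuple - @phi3 R; @phi2 R] i.

Definition T_edge (R : realType) (j : 'I_3) : R * R -> R * R :=
  tnth [tuple @phi2 R - @phi3 R; - @phi1 R - @phi3 R; @phi2 R - @phi1 R] j.

Definition T_cell (R : realType) : R * R -> R * R :=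
  @phi2 R - @phi1 R - @phi3 R.

Definition tensor (R : realType) (n : bipoly R) (l : R * R -> R * R)
    (x : R * R) : R * R := ev n x *: l x.

Definition RT_edge (R : realType) (p : nat) (W : h1_family R p.+1)
    (j : 'I_3) (k : option 'I_p) : R * R -> R * R :=
  if k is Some k then Rgrad (edgef W j k) else @phiI R j.

Definition RT_cell (R : realType) (p : nat) (U : h1_family R p)
    (W : h1_family R p.+1)
    (k : 'I_(ncell p.+1) + ('I_2 + ('I_3 * 'I_p.-1 + 'I_(ncell p)))) :
    R * R -> R * R :=
  match k with
  | inl k => Rgrad (cellf W k)
  | inr (inl i) => tensor (vertf U (widen_ord (isT : (2 <= 3)%N) i)) (@T_vert R i)
  | inr (inr (inl (j, k))) => tensor (edgef U j k) (@T_edge R j)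
  | inr (inr (inr k)) => tensor (cellf U k) (@T_cell R)
  end.

Definition RT (R : realType) (p : nat) (U : h1_family R p)
    (W : h1_family R p.+1) : vector_fe R :=
  VectorFE (RT_edge W) (RT_cell U W).

(* Main.v *)
(** The normal trace of a field on an edge is its cross product with the edge
    tangent. It commutes with the Piola map: the cross product of the mapped
    field with the image of the tangent is the reference cross product. On the
    reference edges the trace of phi_k is the indicator of its own edge, the
    trace of a curl is the tangential derivative of its potential, and the cell
    functions have zero trace. Applying the H^1-continuity of the degree p+1
    basis to the potentials of the curls, the traces of compatible local fields
    agree on every interface, hence so do the one-sided normal traces.

    For affine maps, the divergence theorem on the reference triangle turns the
    weak divergence into a sum of edge fluxes weighted by the test function. The
    weight vanishes on edges that are not interfaces, since they lie outside the
    interior of the domain, and the other edges cancel in pairs, since the two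
    elements at an interface lie on opposite sides of it. *)

Require Import Defs.
From HB Require Import structures.
From mathcomp Require Import all_boot all_order all_algebra.
From mathcomp Require Import all_classical all_reals all_analysis.
From mathcomp Require Import measurable_realfun ring lra.

Set Implicit Arguments.
Unset Strict Implicit.
Unset Printing Implicit Defensive.

Import Order.TTheory GRing.Theory Num.Theory.
Import numFieldTopology.Exports numFieldNormedType.Exports.

Local Open Scope classical_set_scope.
Local Open Scope ring_scope.

(** * Measurability and substitution in the plane *)

(** The delicate point is orientation. The Piola map divides by the signed determinant, whereas
    integrals scale with its absolute value, so an edge flux keeps the sign of the determinant
    besides the orientation of the reference edge. Mapped tangents and traces coincide on an
    interface, so two fluxes cancel once these sign factors are opposite. That is not a field of
    [mesh]; it is extracted from conformity, because two elements on the same side of an edge would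
    overlap in more than an edge. The same sign rule excludes three elements sharing an edge, which
    makes the pairing of edges an involution. Potentials and element maps are compared only for
    parameters in [0, 1], so derivatives at the end points are identified through one-sided limits.
    For affine maps the fields are polynomial on the whole plane and the element maps have global
    inverses, so integrals over elements become integrals over the plane of functions extended by
    zero. *)

Section Measurability.
Context {R : realType}.

(** The measurable sets of the plane are generated by rectangles, so an open set is exhausted by
    countably many squares with rational centre and radius. *)
Lemma open_measurable2 (U : set (R * R)) : open U -> measurable U.
Proof.
move=> oU.
have -> : U = \bigcup_(a : rat) \bigcup_(b : rat) \bigcup_(r : rat)
    (if pselect (ball (ratr a : R) (ratr r) `*` ball (ratr b : R) (ratr r) `<=` U)
     then ball (ratr a : R) (ratr r) `*` ball (ratr b : R) (ratr r) else set0).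
  apply/seteqP; split => [[x y] Uxy|]; last first.
    by move=> z [a _ [b _ [r _]]]; case: pselect => [sU /sU|_ []].
  have [e /= e0 He] : exists2 e : R, 0 < e & ball (x, y) e `<=` U.
    have := open_nbhs_nbhs (conj oU Uxy).
    by rewrite -nbhs_ballE => -[e e0 ?]; exists e.
  (* Twice the radius stays below [e], so a square around [(a, b)] that contains [(x, y)] lies in
     the ball of radius [e] at [(x, y)]. *)
  have [r /itvP rI] : exists q : rat, ratr q \in `]0, (e / 2)[%R.
    by apply: rat_in_itvoo; rewrite divr_gt0.
  have r0 : 0 < ratr r :> R by rewrite rI.
  have [a /itvP aI] : exists q : rat, ratr q \in `](x - ratr r), (x + ratr r)[%R.
    by apply: rat_in_itvoo; lra.
  have [b /itvP bI] : exists q : rat, ratr q \in `](y - ratr r), (y + ratr r)[%R.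
    by apply: rat_in_itvoo; lra.
  have re : ratr r < e / 2 :> R by rewrite rI.
  have xa : `|ratr a - x| < ratr r.
    by rewrite ltr_distl !aI.
  have yb : `|ratr b - y| < ratr r.
    by rewrite ltr_distl !bI.
  exists a => //; exists b => //; exists r => //.
  case: pselect => [sU|nsub]; first by split.
  exfalso; apply: nsub => -[u v] [/= ua vb]; apply: He; split => /=.
    have := ler_distD (ratr a) x u; move: ua xa; rewrite /ball /= (distrC x (ratr a)).
    by move: (ratr a) (ratr r) (`|_|) re => *; lra.
  have := ler_distD (ratr b) y v; move: vb yb; rewrite /ball /= (distrC y (ratr b)).
  by move: (ratr b) (ratr r) (`|_|) re => *; lra.
apply: bigcupT_measurable_rat => a; apply: bigcupT_measurable_rat => b.
apply: bigcupT_measurable_rat => r; case: pselect => [sU|nsU]; last exact: measurable0.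
by apply: measurableX; apply: open_measurable; exact: ball_open.
Qed.

Lemma continuous_measurable_fun2 (f : R * R -> R) :
  continuous f -> measurable_fun setT f.
Proof.
move=> /continuousP cf.
apply: (measurability _ (RGenOpens.measurableE R)).
move=> _ [_ [a [b ->] <-]]; rewrite setTI; apply: open_measurable2.
exact/cf/interval_open.
Qed.

End Measurability.

(** * Affine change of variables on the line *)

Section AffineSubstitution.
Context {R : realType}.
Local Open Scope ereal_scope.
Local Notation mu := (@lebesgue_measure R).

(** Both sides are measures in [A] that agree on half-open intervals, and these determine Lebesgue
    measure. For negative [a] the preimage of an interval is half-open at the other end, with the
    same length. *)
Lemma lebesgue_measure_affine (a b : R) (A : set R) : a != 0%R -> measurable A ->
  `|a|%:E * mu [set x | A (a * x + b)%R] = mu A.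
Proof.
move=> a0 mA.
have maff : measurable_fun [set: measurableTypeR R]
    ((fun x => a * x + b)%R : measurableTypeR R -> measurableTypeR R).
  apply: continuous_measurable_fun => x; apply: cvgD; last exact: cvg_cst.
  by apply: cvgM; [exact: cvg_cst|exact: cvg_id].
pose m := mscale (NngNum (normr_ge0 a)) (pushforward mu
  ((fun x => a * x + b)%R : measurableTypeR R -> measurableTypeR R)).
have -> : `|a|%:E * mu [set x | A (a * x + b)%R] = m maff A by [].
apply/esym/lebesgue_measure_unique => //= _ [[c d]] _ <-.
rewrite /m /mscale/= /pushforward/= lebesgue_measure_itv/= lte_fin.
have [a_gt0|a_le0] := ltP 0%R a.
- have -> : (fun x => a * x + b)%R @^-1` `]c, d]%classic
      = `]((c - b) / a)%R, ((d - b) / a)%R]%classic.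
    apply/seteqP; split => x /=; rewrite !in_itv/= ltr_pdivrMr// ler_pdivlMr//;
    by move=> /andP[? ?]; apply/andP; split; lra.
  rewrite lebesgue_measure_itv/= lte_fin ltr_pM2r ?invr_gt0// ltrD2r.
  case: ifPn => // _; last by rewrite mule0.
  rewrite gtr0_norm// -!EFinB -EFinM; congr EFin; field; lra.
- have a_lt0 : (a < 0)%R by rewrite lt_neqAle a0.
  have -> : (fun x => a * x + b)%R @^-1` `]c, d]%classic
      = `[((d - b) / a)%R, ((c - b) / a)%R[%classic.
    apply/seteqP; split => x /=; rewrite !in_itv/= ler_ndivrMr// ltr_ndivlMr//;
    by move=> /andP[? ?]; apply/andP; split; lra.
  rewrite lebesgue_measure_itv/= lte_fin ltr_nM2r ?invr_lt0// ltrD2r.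
  case: ifPn => // _; last by rewrite mule0.
  rewrite ltr0_norm// -!EFinB -EFinM; congr EFin; field; lra.
Qed.

Lemma ge0_integral_affine (a b : R) (f : R -> \bar R) : a != 0%R ->
  measurable_fun setT f -> (forall x, 0 <= f x) ->
  `|a|%:E * \int[mu]_x f (a * x + b)%R = \int[mu]_x f x.
Proof.
move=> a0 mf f0.
have maff : measurable_fun [set: measurableTypeR R]
    ((fun x => a * x + b)%R : measurableTypeR R -> measurableTypeR R).
  apply: continuous_measurable_fun => x; apply: cvgD; last exact: cvg_cst.
  by apply: cvgM; [exact: cvg_cst|exact: cvg_id].
have := @ge0_integral_pushforward _ _ _ _ R _ maff mu setT f measurableT mf
  (fun x _ => f0 x).
rewrite preimage_setT => <-.
rewrite (eq_measure_integral (mscale (NngNum (normr_ge0 (a^-1)%R)) mu)); last first.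
  move=> A mA _; rewrite /= /mscale/= -(lebesgue_measure_affine b a0 mA) muleA.
  by rewrite -EFinM -normrM mulVf// normr1 mul1e.
rewrite ge0_integral_mscale//= muleA -EFinM -normrM mulfV// normr1 mul1e//.
Qed.

End AffineSubstitution.

(** * Affine change of variables in the plane *)

Section PlaneSubstitution.
Context {R : realType}.
Local Open Scope ereal_scope.
Local Notation mR := (measurableTypeR R).
Implicit Types (X Y : mR * mR -> mR * mR) (c d : R).

(** Change of variables with constant Jacobian factor [c]. For nonnegative functions Tonelli asks
    for no integrability, and the property is stable under composition; signed functions follow in
    [Rintegral_substitutes]. *)
Definition substitutes X c := measurable_fun setT X /\
  forall f : mR * mR -> \bar R, measurable_fun setT f -> (forall z, 0 <= f z) ->
  c%:E * \int[leb2 R]_z f (X z) = \int[leb2 R]_z f z.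

Lemma substitutes_comp X Y c d :
  substitutes X c -> substitutes Y d -> substitutes (X \o Y) (c * d).
Proof.
move=> [mX sX] [mY sY]; split; first exact: measurableT_comp.
move=> f mf f0; rewrite EFinM -muleA -(sX f)//; congr (_ * _).
by apply: (sY (f \o X)) => [|z]; [exact: measurableT_comp|exact: f0].
Qed.

(** With the second coordinate [y] fixed, the shear is an affine map of the line with slope [a] and
    translation [b * y + c]. *)
Lemma substitutes_shear (a b c : R) : a != 0%R ->
  substitutes (fun z : mR * mR => (a * z.1 + b * z.2 + c, z.2))%R `|a|.
Proof.
move=> a0; have mX : measurable_fun [set: mR * mR]
    (fun z : mR * mR => (a * z.1 + b * z.2 + c, z.2) : mR * mR)%R.
  apply: measurable_fun_pair; last exact: measurable_snd.
  apply: measurable_funD; last exact: measurable_cst.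
  by apply: measurable_funD; apply: measurable_funM;
    [exact: measurable_cst|exact: measurable_fst|
     exact: measurable_cst|exact: measurable_snd].
split=> // f mf f0; rewrite /leb2.
rewrite (fubini_tonelli2 f)// /fubini_G.
rewrite (fubini_tonelli2 (fun z : mR * mR => f (a * z.1 + b * z.2 + c, z.2)%R))//; last first.
  exact: measurableT_comp mf mX.
rewrite -ge0_integralZl//; last 2 first.
- apply: (measurable_fun_fubini_tonelli_G
    (fun z : mR * mR => f (a * z.1 + b * z.2 + c, z.2)%R)) => //.
  exact: measurableT_comp mf mX.
- by move=> y _; exact: integral_ge0.
apply: eq_integral => y _; rewrite /fubini_G/=.
under [X in _ * X]eq_integral => x _ do rewrite -addrA.
rewrite (@ge0_integral_affine _ a (b * y + c)%R (fun x : mR => f (x, y)))//.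
by apply: measurableT_comp => //; exact: measurable_fun_pair.
Qed.

Lemma substitutes_swap : substitutes (fun z : mR * mR => (z.2, z.1)) 1.
Proof.
have mX : measurable_fun [set: mR * mR] (fun z : mR * mR => (z.2, z.1) : mR * mR).
  by apply: measurable_fun_pair; [exact: measurable_snd|exact: measurable_fst].
split=> // f mf f0; rewrite mul1e /leb2.
rewrite (fubini_tonelli1 (fun z : mR * mR => f (z.2, z.1)))//; last first.
  exact: measurableT_comp mf mX.
by rewrite (fubini_tonelli2 f).
Qed.

Definition affine2 (a b c : R * R) (z : R * R) : R * R :=
  (a + z.1 *: b + z.2 *: c)%R.

Definition cross (u v : R * R) : R := (u.1 * v.2 - u.2 * v.1)%R.

(** Gaussian elimination with pivot [c.2]: the map is a shear of the first coordinate after a shear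
    of the second, the latter being a shear conjugated by the swap. If the pivot vanishes then [b.2]
    does not, and exchanging [b] and [c] costs one more swap. *)
Lemma substitutes_affine (a b c : R * R) : cross b c != 0%R ->
  substitutes (affine2 a b c) `|cross b c|.
Proof.
have key (a' b' c' : R * R) : c'.2 != 0%R -> cross b' c' != 0%R ->
    substitutes (affine2 a' b' c') `|cross b' c'|.
  move=> c0 d0; have q0 : (cross b' c' / c'.2)%R != 0%R by rewrite mulf_neq0// invr_neq0.
  have := substitutes_comp
   (substitutes_shear (c'.1 / c'.2) (a'.1 - c'.1 / c'.2 * a'.2) q0)
   (substitutes_comp substitutes_swap
     (substitutes_comp (substitutes_shear b'.2 a'.2 c0) substitutes_swap)).
  rewrite mul1r mulr1 -normrM divfK//; congr (substitutes _ _).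
  apply/funext => -[x y]; rewrite /affine2 /cross/=.
  case: a' b' c' c0 {d0 q0} => [a1 a2] [b1 b2] [c1 c2] /= c0.
  by congr pair => /=; rewrite /GRing.scale/=; field.
move=> d0; have [c0|] := eqVneq c.2 0%R; last by move/key; apply.
have b0 : b.2 != 0%R.
  by apply: contraNneq d0 => b0; rewrite /cross c0 b0 mulr0 mul0r subrr.
have E : cross c b = (- cross b c)%R by rewrite /cross; ring.
have := substitutes_comp (key a c b b0 _) substitutes_swap.
rewrite E oppr_eq0 normrN mulr1 => /(_ d0); congr (substitutes _ _).
by apply/funext => z; rewrite /affine2/= addrAC.
Qed.

End PlaneSubstitution.

HB.instance Definition _ (R : realType) := Measure.on (leb2 R).

(** * Integrability and substitution for signed functions in the plane *)

Section PlaneIntegrability.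
Context {R : realType}.
Local Notation mR := (measurableTypeR R).
Local Notation mu2 := (leb2 R).
Implicit Types (X Y : mR * mR -> mR * mR) (c d : R) (f g : mR * mR -> R).

Lemma integrable_restrict_bounded (D : set (mR * mR)) f M :
  measurable D -> (mu2 D < +oo)%E -> measurable_fun setT f ->
  (forall z, D z -> `|f z| <= M) -> mu2.-integrable setT (EFin \o (f \_ D)).
Proof.
move=> mD Dfin mf fM; rewrite -restrict_EFin; apply: (iffLR (integrable_mkcond _ mD)).
apply: measurable_bounded_integrable => //; first exact: measurable_funTS.
exists M; split; first exact: num_real.
by move=> x Mx z /= /fM /le_trans; apply; exact: ltW.
Qed.

Lemma integrable_sqr_Lfun2 f : measurable_fun setT f ->
  mu2.-integrable setT (EFin \o (fun z => f z ^+ 2)) -> f \in Lfun mu2 2%:E.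
Proof.
move=> mf /integrableP[_ fin]; rewrite inE; apply/andP; split.
  by rewrite inE.
rewrite inE/= /finite_norm unlock; apply: poweR_lty.
move: fin; congr (_ < _)%E; apply: eq_integral => z _ /=.
by rewrite powR_mulrn// normrX.
Qed.

(** The integral of the absolute value of [f] is [c] times that of [f \o X], so integrability passes
    from the reference side to the image. *)
Lemma integrable_substitutes X c f : substitutes X c -> measurable_fun setT f ->
  mu2.-integrable setT (EFin \o (f \o X)) -> mu2.-integrable setT (EFin \o f).
Proof.
move=> [mX sX] mf /integrableP[_ fin]; apply/integrableP; split.
  exact/measurable_EFinP.
rewrite -(sX (fun z => `|(f z)%:E|%E))//; last first.
  by apply/measurable_EFinP; exact: measurableT_comp.
have /= Ifin : (\int[mu2]_z `|(EFin \o (f \o X)) z|)%E \is a fin_num.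
  by rewrite ge0_fin_numE// integral_ge0.
by rewrite ltey_eq fin_numM.
Qed.

Lemma Rintegral_substitutes X c f : substitutes X c -> measurable_fun setT f ->
  mu2.-integrable setT (EFin \o (f \o X)) ->
  c * \int[mu2]_z f (X z) = \int[mu2]_z f z.
Proof.
move=> sXc mf ifX; have if_ := integrable_substitutes sXc mf ifX.
case: sXc => mX sX.
have mfE : measurable_fun setT (EFin \o f) by exact/measurable_EFinP.
rewrite /Rintegral -[c in LHS]/(fine c%:E) -fineM//; last exact: integrable_fin_num.
congr fine; rewrite integralE [RHS]integralE muleBr//; last first.
  exact: (integrable_add_def measurableT ifX).
congr (_ - _)%E.
  rewrite -(sX (EFin \o f)^\+%E)//; last exact: measurable_funepos.
  by congr (_ * _)%E; apply: eq_integral => z _; rewrite !(funeposE, funenegE).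
rewrite -(sX (EFin \o f)^\-%E)//; last exact: measurable_funeneg.
by congr (_ * _)%E; apply: eq_integral => z _; rewrite !(funeposE, funenegE).
Qed.

End PlaneIntegrability.

(** * The reference triangle as a domain of integration *)

Section ReferenceTriangle.
Context {R : realType}.
Local Notation mR := (measurableTypeR R).
Local Notation mu2 := (leb2 R).

Definition Gint : set (R * R) :=
  [set z | [/\ 0 < z.1, 0 < z.2 & z.1 + z.2 < 1]].

Lemma GintE : (Gam R)^° = Gint.
Proof.
apply/seteqP; split => [[x y]|].
  rewrite /interior/= -nbhs_ballE => -[e /= e0 sub].
  (* The point below on the diagonal makes the two sign constraints strict, the point above makes
     the third constraint strict. *)
  have e20 : 0 < e / 2 by rewrite divr_gt0.
  have /sub[/= lx ly _] : ball (x, y) e (x - e / 2, y - e / 2).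
    by split; rewrite /ball/= opprB addrC subrK gtr0_norm//; lra.
  have /sub[/= _ _ lxy] : ball (x, y) e (x + e / 2, y + e / 2).
    by split; rewrite /ball/= opprD addNKr normrN gtr0_norm//; lra.
  by split => /=; lra.
have cD : continuous (fun z : R * R => z.1 + z.2).
  by move=> z; apply: cvgD; [exact: cvg_fst|exact: cvg_snd].
have -> : Gint = fst @^-1` [set x | 0 < x] `&` (snd @^-1` [set x | 0 < x]
    `&` (fun z : R * R => z.1 + z.2) @^-1` [set x | x < 1]).
  by apply/seteqP; split => z [] //= ? []; split.
rewrite -open_subsetE.
  by move=> z [/= x0 [/= y0 xy]]; split; apply: ltW.
have [of' os] : open (fst @^-1` [set x | 0 < x] : set (R * R)) /\
    open (snd @^-1` [set x | 0 < x] : set (R * R)).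
  by split; apply: open_comp (@open_gt R 0) => z _; [exact: cvg_fst|exact: cvg_snd].
by apply: openI of' (openI os (open_comp _ (@open_lt R 1))) => z _; exact: cD.
Qed.

Lemma measurable_Gint : measurable (Gint : set (mR * mR)).
Proof. by rewrite -GintE; apply: open_measurable2; exact: open_interior. Qed.

Lemma compact_square : compact (`[0, 1] `*` `[0, 1] : set (R * R)).
Proof. by apply: compact_setX; exact: segment_compact. Qed.

Lemma Gam_square : Gam R `<=` `[0, 1] `*` `[0, 1].
Proof. by move=> z [? ? ?]; split; rewrite /= in_itv/=; apply/andP; split; lra. Qed.

Lemma Gint_Gam : Gint `<=` Gam R.
Proof. by rewrite -GintE; exact: interior_subset. Qed.

Lemma leb2_Gint_lty : (mu2 (Gint : set (mR * mR)) < +oo)%E.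
Proof.
apply: (@le_lt_trans _ _ (mu2 (`[0, 1] `*` `[0, 1] : set (mR * mR)))).
  apply: le_measure; rewrite ?inE; first exact: measurable_Gint.
    by apply: measurableX; exact: measurable_itv.
  exact: subset_trans Gint_Gam Gam_square.
rewrite /leb2 product_measure1E// ?lebesgue_measure_itv /=; try exact: measurable_itv.
by rewrite lebesgue_measure_itv/= lte_fin ltr01 oppr0 adde0 mule1 ltry.
Qed.

Lemma continuous_Gint_integrable (f : R * R -> R) : continuous f ->
  mu2.-integrable setT (EFin \o ((f : mR * mR -> R) \_ Gint)).
Proof.
move=> cf.
have /compact_bounded[M [_ /(_ (`|M| + 1) _)]] :
    compact (f @` (`[0, 1] `*` `[0, 1])).
  by apply: continuous_compact compact_square; exact: continuous_subspaceT.
rewrite (le_lt_trans (ler_norm _)) ?ltrDl// => /(_ isT) fM.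
apply: (@integrable_restrict_bounded _ _ _ (`|M| + 1)).
- exact: measurable_Gint.
- exact: leb2_Gint_lty.
- exact: continuous_measurable_fun2.
- by move=> z /Gint_Gam/Gam_square Gz; apply: fM; exists z.
Qed.

End ReferenceTriangle.

(** * The divergence theorem on the reference triangle *)

Section ReferenceDivergence.
Context {R : realType}.
Local Notation mR := (measurableTypeR R).
Local Notation mu := (@lebesgue_measure R).
Local Notation mu2 := (leb2 R).

Lemma continuous_unit_integrable (g : R -> R) : continuous g ->
  mu.-integrable `[0, 1] (EFin \o g).
Proof.
move=> cg; apply: continuous_compact_integrable; first exact: segment_compact.
exact: continuous_subspaceT.
Qed.

Lemma continuous_pair (T : topologicalType) (f g : T -> R) :
  continuous f -> continuous g -> continuous (fun s => (f s, g s)).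
Proof.
move=> cf cg x; apply: (@cvg_pair _ _ _ _ (nbhs (f x)) (nbhs (g x))); [exact: cf|exact: cg].
Qed.

Lemma continuous_comp_pair (T : topologicalType) (F : R * R -> R) (f g : T -> R) :
  continuous F -> continuous f -> continuous g -> continuous (fun x => F (f x, g x)).
Proof.
move=> cF cf cg x; apply: (@continuous_comp _ _ _ (fun x => (f x, g x)) F); last exact: cF.
exact: continuous_pair.
Qed.

Lemma continuous_const (T : topologicalType) (c : R) : continuous (fun _ : T => c).
Proof. by move=> x; exact: cvg_cst. Qed.

Lemma continuous_idfun : continuous (fun t : R => t).
Proof. by move=> x; exact: cvg_id. Qed.

Lemma continuous_onem : continuous (fun t : R => 1 - t).
Proof. by move=> x; apply: cvgB; [exact: cvg_cst|exact: cvg_id]. Qed.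

Lemma derivative_integral (g dg : R -> R) (b : R) : 0 < b ->
  continuous dg -> (forall x : R, is_derive x 1 g (dg x)) ->
  (\int[mu]_x (((dg \_ `]0%R, b[) x)%:E) = (g b - g 0)%:E)%E.
Proof.
move=> b0 cdg ddg.
have cg : continuous g.
  move=> x; apply: differentiable_continuous; apply/derivable1_diffP.
  by case: (ddg x).
rewrite EFinB -(@continuous_FTC2 _ dg g 0 b)//.
- rewrite -integral_itv_obnd_cbnd; last first.
    by apply/measurable_EFinP; apply: measurable_funTS; exact: continuous_measurable_fun.
  rewrite -integral_itv_bndo_bndc; last first.
    by apply/measurable_EFinP; apply: measurable_funTS; exact: continuous_measurable_fun.
  rewrite [RHS]integral_mkcond; apply: eq_integral => x _.
  by rewrite !patchE; case: ifP.
- exact: continuous_subspaceT.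
- split; first by move=> x _; have [] := ddg x.
  + by apply: cvg_at_right_filter; exact: cg.
  + by apply: cvg_at_left_filter; exact: cg.
- by move=> x _; rewrite derive1E; have [] := ddg x.
Qed.

(** Fubini and the fundamental theorem on horizontal slices: the slice at height [y] runs from 0 to
    [1 - y], so only the edges [e_12] and [e_23] contribute. *)
Lemma Rintegral_Gint_dx (F D : R * R -> R) :
  continuous F -> continuous D ->
  (forall x y : R, is_derive x 1 (fun x' => F (x', y)) (D (x, y))) ->
  \int[mu2]_z ((D : mR * mR -> R) \_ Gint) z
  = \int[mu]_(t in `[0, 1]) (F (1 - t, t) - F (0, t)).
Proof.
move=> cF cD dF; rewrite /Rintegral; congr fine.
have iD := continuous_Gint_integrable cD.
rewrite -(integral21_prod_meas1 iD) /fubini_G/=.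
transitivity (\int[mu]_y (((fun t => F (1 - t, t) - F (0, t)) \_ `]0%R, 1%R[) y)%:E)%E.
  apply: eq_integral => y _.
  have [y01|ny01] := boolP (y \in `]0%R, 1%R[).
    rewrite [in RHS]patchE mem_set//.
    have y1 : 0 < 1 - y by move: y01; rewrite in_itv/= => /andP[_ ?]; lra.
    rewrite -(@derivative_integral (fun x => F (x, y)) (fun x => D (x, y)) _ y1)//.
    - apply: eq_integral => x _; rewrite !patchE.
      congr (if _ then _ else _)%:E; apply/idP/idP => /set_mem.
        by case=> /= ? ? ?; apply/mem_set => /=; rewrite in_itv/=; apply/andP; split => //; lra.
      rewrite /= in_itv/= => /andP[? ?]; apply/mem_set; move: y01.
      by rewrite in_itv/= => /andP[? ?]; split => //=; lra.
    - apply: continuous_comp_pair => //; [exact: continuous_idfun|exact: continuous_const].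
  rewrite [in RHS]patchE memNset; last exact/negP.
  rewrite -[RHS](integral0 mu setT); apply: eq_integral => x _.
  rewrite patchE memNset// => -[/= ? ? ?]; move: ny01; rewrite in_itv/= negb_and.
  by rewrite -!leNgt => /orP[]; lra.
have cG : continuous (fun t : R => F (1 - t, t) - F (0, t)).
  move=> t; apply: cvgB; apply: continuous_comp_pair => //;
    [exact: continuous_onem|exact: continuous_idfun|exact: continuous_const|
     exact: continuous_idfun].
rewrite -integral_itv_obnd_cbnd; last first.
  by apply/measurable_EFinP; apply: measurable_funTS; exact: continuous_measurable_fun.
rewrite -integral_itv_bndo_bndc; last first.
  by apply/measurable_EFinP; apply: measurable_funTS; exact: continuous_measurable_fun.
rewrite [RHS]integral_mkcond; apply: eq_integral => x _.
by rewrite !patchE; case: ifP.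
Qed.

Lemma continuous_swap (F : R * R -> R) : continuous F ->
  continuous (fun z : R * R => F (z.2, z.1)).
Proof.
move=> cF; apply: continuous_comp_pair => // z; [exact: cvg_snd|exact: cvg_fst].
Qed.

Lemma Rintegral_Gint_dy (F D : R * R -> R) :
  continuous F -> continuous D ->
  (forall x y : R, is_derive y 1 (fun y' => F (x, y')) (D (x, y))) ->
  \int[mu2]_z ((D : mR * mR -> R) \_ Gint) z
  = \int[mu]_(t in `[0, 1]) (F (t, 1 - t) - F (t, 0)).
Proof.
move=> cF cD dF.
have <- := @Rintegral_Gint_dx (fun z => F (z.2, z.1)) (fun z => D (z.2, z.1))
  (continuous_swap cF) (continuous_swap cD) (fun x y => dF y x).
have E : (D : mR * mR -> R) \_ Gint \o (fun z : mR * mR => (z.2, z.1)) =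
    ((fun z : mR * mR => D (z.2, z.1)) : mR * mR -> R) \_ Gint.
  apply/funext => -[x y]; rewrite /= !patchE; congr (if _ then _ else _).
  by apply/idP/idP => /set_mem[/= ? ? ?]; apply/mem_set; split => //=; rewrite addrC.
rewrite -(Rintegral_substitutes (@substitutes_swap R)) ?mul1r//.
- by rewrite -E.
- apply/(measurable_restrictT _ measurable_Gint); apply: measurable_funTS.
  exact: continuous_measurable_fun2.
- by rewrite E; apply: continuous_Gint_integrable; exact: continuous_swap.
Qed.

Lemma edge_tangent0 : edge_tangent R (@Ordinal 3 0 isT) = (0, 1).
Proof.
by rewrite /edge_tangent /edge_src /edge_tgt /vtx !(tnth_nth 0)/=; congr pair => /=; ring.
Qed.

Lemma edge_tangent1 : edge_tangent R (@Ordinal 3 1 isT) = (1, 0).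
Proof.
by rewrite /edge_tangent /edge_src /edge_tgt /vtx !(tnth_nth 0)/=; congr pair => /=; ring.
Qed.

Lemma edge_tangent2 : edge_tangent R (@Ordinal 3 2 isT) = (1, -1).
Proof.
by rewrite /edge_tangent /edge_src /edge_tgt /vtx !(tnth_nth 0)/=; congr pair => /=; ring.
Qed.

Lemma edge_par0 t : edge_par (@Ordinal 3 0 isT) t = (0, t) :> R * R.
Proof.
rewrite /edge_par edge_tangent0 /edge_src /vtx !(tnth_nth 0)/=.
by congr pair; rewrite /= /GRing.scale/=; ring.
Qed.

Lemma edge_par1 t : edge_par (@Ordinal 3 1 isT) t = (t, 0) :> R * R.
Proof.
rewrite /edge_par edge_tangent1 /edge_src /vtx !(tnth_nth 0)/=.
by congr pair; rewrite /= /GRing.scale/=; ring.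
Qed.

Lemma edge_par2 t : edge_par (@Ordinal 3 2 isT) t = (t, 1 - t) :> R * R.
Proof.
rewrite /edge_par edge_tangent2 /edge_src /vtx !(tnth_nth 0)/=.
by congr pair; rewrite /= /GRing.scale/=; ring.
Qed.

Lemma ord3_cases (P : 'I_3 -> Prop) : P (@Ordinal 3 0 isT) -> P (@Ordinal 3 1 isT) ->
  P (@Ordinal 3 2 isT) -> forall i, P i.
Proof.
move=> P0 P1 P2 [[|[|[|//]]] lti].
- by rewrite (_ : Ordinal _ = @Ordinal 3 0 isT) //; exact: val_inj.
- by rewrite (_ : Ordinal _ = @Ordinal 3 1 isT) //; exact: val_inj.
- by rewrite (_ : Ordinal _ = @Ordinal 3 2 isT) //; exact: val_inj.
Qed.

Lemma sum_ord3 (f : 'I_3 -> R) : \sum_i f i =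
  f (@Ordinal 3 0 isT) + f (@Ordinal 3 1 isT) + f (@Ordinal 3 2 isT).
Proof.
rewrite !big_ord_recl big_ord0 addr0 addrA; congr (f _ + f _ + f _); exact: val_inj.
Qed.

(** This sign times the cross product with the edge tangent is the outward flux density. It is 1
    when the edge, run from its source to its target, has the triangle on its left, and -1
    otherwise. *)
Definition edge_sign (i : 'I_3) : R := tnth [tuple -1; 1; -1] i.

Lemma Rintegral_Gint_div (F1 F2 D1 D2 : R * R -> R) :
  continuous F1 -> continuous F2 -> continuous D1 -> continuous D2 ->
  (forall x y : R, is_derive x 1 (fun x' => F1 (x', y)) (D1 (x, y))) ->
  (forall x y : R, is_derive y 1 (fun y' => F2 (x, y')) (D2 (x, y))) ->
  \int[mu2]_z (((fun z => D1 z + D2 z) : mR * mR -> R) \_ Gint) z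
  = \sum_i edge_sign i * \int[mu]_(t in `[0, 1])
      cross (F1 (edge_par i t), F2 (edge_par i t)) (edge_tangent R i).
Proof.
move=> cF1 cF2 cD1 cD2 dF1 dF2.
have -> : ((fun z => D1 z + D2 z) : mR * mR -> R) \_ Gint
    = (fun z => ((D1 : mR * mR -> R) \_ Gint) z + ((D2 : mR * mR -> R) \_ Gint) z).
  by apply/funext => z; rewrite !patchE; case: ifP => // _; rewrite addr0.
rewrite RintegralD//; try exact: continuous_Gint_integrable.
rewrite (Rintegral_Gint_dx cF1 cD1 dF1) (Rintegral_Gint_dy cF2 cD2 dF2).
have c10 : continuous (fun t : R => F1 (0, t)).
  by apply: continuous_comp_pair => //; [exact: continuous_const|exact: continuous_idfun].
have c20 : continuous (fun t : R => F2 (t, 0)).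
  by apply: continuous_comp_pair => //; [exact: continuous_idfun|exact: continuous_const].
have ct1 (F : R * R -> R) : continuous F -> continuous (fun t : R => F (t, 1 - t)).
  by move=> cF; apply: continuous_comp_pair => //;
    [exact: continuous_idfun|exact: continuous_onem].
have c11 : continuous (fun t : R => F1 (1 - t, t)).
  exact: (ct1 (fun z => F1 (z.2, z.1)) (continuous_swap cF1)).
rewrite !RintegralB//; try by apply: continuous_unit_integrable => //; exact: ct1.
(* The horizontal slices run through [e_23] against the direction of [edge_par]. *)
have -> : \int[mu]_(t in `[0, 1]) F1 (1 - t, t) = \int[mu]_(t in `[0, 1]) F1 (t, 1 - t).
  have := @Rintegration_by_substitution_onem R (fun t => F1 (1 - t, t)) 1.
  rewrite /unstable.onem subrr => ->; first last.
  - exact: continuous_subspaceT.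
  - by rewrite ler01 lexx.
  by apply: eq_Rintegral => t _; rewrite opprB addrC subrK.
rewrite sum_ord3 /edge_sign !(tnth_nth 0)/=.
have -> : \int[mu]_(t in `[0, 1]) cross (F1 (edge_par (@Ordinal 3 0 isT) t),
    F2 (edge_par (@Ordinal 3 0 isT) t)) (edge_tangent R (@Ordinal 3 0 isT))
  = \int[mu]_(t in `[0, 1]) F1 (0, t).
  by apply: eq_Rintegral => t _; rewrite edge_par0 edge_tangent0 /cross/=; ring.
have -> : \int[mu]_(t in `[0, 1]) cross (F1 (edge_par (@Ordinal 3 1 isT) t),
    F2 (edge_par (@Ordinal 3 1 isT) t)) (edge_tangent R (@Ordinal 3 1 isT))
  = - \int[mu]_(t in `[0, 1]) F2 (t, 0).
  rewrite -mulN1r -RintegralZl//; last exact: continuous_unit_integrable.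
  by apply: eq_Rintegral => t _; rewrite edge_par1 edge_tangent1 /cross/=; ring.
have -> : \int[mu]_(t in `[0, 1]) cross (F1 (edge_par (@Ordinal 3 2 isT) t),
    F2 (edge_par (@Ordinal 3 2 isT) t)) (edge_tangent R (@Ordinal 3 2 isT))
  = - (\int[mu]_(t in `[0, 1]) F1 (t, 1 - t) + \int[mu]_(t in `[0, 1]) F2 (t, 1 - t)).
  rewrite -RintegralD//; try by apply: continuous_unit_integrable => //; exact: ct1.
  rewrite -mulN1r -RintegralZl//; last first.
    apply: (@continuous_unit_integrable (fun t => F1 (t, 1 - t) + F2 (t, 1 - t))).
    by move=> t; apply: cvgD; exact: ct1.
  by apply: eq_Rintegral => t _; rewrite edge_par2 edge_tangent2 /cross/=; ring.
ring.
Qed.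

End ReferenceDivergence.

(** * Normal traces of the shape functions *)

Section PolynomialFields.
Context {R : realType}.
Implicit Types (m n : bipoly R) (x u v : R * R) (a b c t : R).

Lemma evD m n x : ev (m + n) x = ev m x + ev n x.
Proof. by rewrite /ev !hornerE. Qed.

Lemma evN n x : ev (- n) x = - ev n x.
Proof. by rewrite /ev !hornerE. Qed.

Lemma evM m n x : ev (m * n) x = ev m x * ev n x.
Proof. by rewrite /ev !hornerE. Qed.

Lemma evZ c n x : ev (c%:P *: n) x = c * ev n x.
Proof. by rewrite /ev !hornerE. Qed.

Lemma continuous_ev n : continuous (ev n).
Proof.
elim/poly_ind: n => [|n p IH] z.
  rewrite (_ : ev 0 = fun=> 0); first exact: cvg_cst.
  by apply/funext => z'; rewrite /ev !hornerE.
rewrite (_ : ev _ = fun z => ev n z * z.2 + p.[z.1]); last first.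
  by apply/funext => z'; rewrite /ev !hornerE.
apply: cvgD; first by apply: cvgM; [exact: IH|exact: cvg_snd].
apply: (@continuous_comp _ _ _ fst (horner p)); first exact: cvg_fst.
exact: continuous_horner.
Qed.

Lemma dxi_MXaddC n (p : {poly R}) : dxi (n * 'X + p%:P) = dxi n * 'X + p^`()%:P.
Proof.
apply/polyP => i; rewrite /dxi coef_map !coefD !coefMX !coefC.
by case: i => [|i] /=; rewrite ?add0r ?addr0 // coef_map.
Qed.

Lemma deta_MXaddC n (p : {poly R}) : deta (n * 'X + p%:P) = deta n * 'X + n.
Proof. by rewrite /deta derivD derivC addr0 derivM derivX mulr1. Qed.

Lemma is_derive_ev n x v t :
  is_derive t 1 (fun s => ev n (x + s *: v))
    (v.1 * ev (dxi n) (x + t *: v) + v.2 * ev (deta n) (x + t *: v)).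
Proof.
have lin a b : is_derive t 1 (fun s => a + s * b) b.
  rewrite (_ : (fun s => _) = cst a + (id * cst b : R -> R)); last exact/funext.
  by apply: is_derive_eq; rewrite /GRing.scale/= mulr0 mulr1 !add0r.
elim/poly_ind: n => [|n p IH].
  rewrite (_ : (fun _ => _) = fun=> 0); last first.
    by apply/funext => s; rewrite /ev !hornerE.
  by rewrite /dxi /deta map_poly0 deriv0 /ev !horner0 !mulr0 addr0; exact: is_derive_cst.
rewrite (_ : (fun _ => _) = (fun s => ev n (x + s *: v)) * (fun s => x.2 + s * v.2)
    + (horner p \o (fun s => x.1 + s * v.1))); last first.
  by apply/funext => s; rewrite /ev !hornerE.
have dp : is_derive t 1 (horner p \o (fun s => x.1 + s * v.1)) (p^`().[x.1 + t * v.1] * v.1).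
  by apply: is_derive1_comp; exact: is_derive_poly.
have l2 := lin x.2 v.2; apply: is_derive_eq.
rewrite dxi_MXaddC deta_MXaddC !(evD, evM) /GRing.scale/=.
have E (r : R) : t *: (r : R^o) = t * r by [].
rewrite /ev !hornerE/= !E; ring.
Qed.

End PolynomialFields.

Section EdgeTraces.
Context {R : realType}.
Implicit Types (x u v w : R * R) (t : R).

(** Since both derivatives exist, a one-sided limit already determines their difference. The limit
    is taken on a side that stays in [0, 1], from the right if [t < 1] and from the left at 1; there
    the difference quotient of [f - g] is identically 0. *)
Lemma is_derive_eq_unit (V : normedModType R) (f g : R -> V) df dg t :
  t \in `[0, 1] -> {in `[0, 1], f =1 g} ->
  is_derive t 1 f df -> is_derive t 1 g dg -> df = dg.
Proof.
move=> t01 fg ft gt; apply/eqP; rewrite -subr_eq0; apply/eqP.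
have [dh <-] : is_derive t 1 (f - g) (df - dg) by exact: is_deriveB.
have cv : (fun s => s^-1 *: ((f - g) (s *: 1 + t) - (f - g) t)) @ 0^' --> 'D_1 (f - g) t.
  exact: dh.
have h0 s : s \in `[0, 1] -> (f - g) s = 0.
  by move=> /fg fgs; rewrite -[LHS]/(f s - g s) fgs subrr.
move: (t01); rewrite in_itv/= => /andP[t0 t1].
have zero (F : set_system R) : ProperFilter F ->
    (fun s => s^-1 *: ((f - g) (s *: 1 + t) - (f - g) t)) @ F --> 'D_1 (f - g) t ->
    (\forall s \near F, s + t \in `[0, 1]) -> 'D_1 (f - g) t = 0.
  move=> FF F0 Ft; apply: (@cvg_unique _ _
    ((fun s => s^-1 *: ((f - g) (s *: 1 + t) - (f - g) t)) @ F)).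
  - exact: norm_hausdorff.
  - exact: F0.
  - apply: cvg_near_cst; near=> s.
    rewrite /= (h0 t)// subr0 h0 ?scaler0//.
    by rewrite /GRing.scale/= mulr1; near: s.
have [tlt1|] := ltP t 1.
  apply: (zero (0:R)^'+).
    exact: cvg_dnbhs_at_right.
  near=> s; rewrite in_itv/=; apply/andP; split.
    by apply: addr_ge0 => //; near: s; exact: nbhs_right_ge.
  by rewrite -lerBrDr; near: s; apply: nbhs_right_le; rewrite subr_gt0.
move=> t1'; apply: (zero (0:R)^'-).
  exact: cvg_dnbhs_at_left.
near=> s; rewrite in_itv/=; apply/andP; split.
  rewrite -lerBlDr sub0r; near: s; apply: nbhs_left_ge; lra.
suff : s <= 0 by lra.
by near: s; exact: nbhs_left_le.
Unshelve. all: by end_near. Qed.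

Lemma crossDl u v w : cross (u + v) w = cross u w + cross v w.
Proof. by rewrite /cross/=; ring. Qed.

Lemma crossZl c v w : cross (c *: v) w = c * cross v w.
Proof. by rewrite /cross/= /GRing.scale/=; ring. Qed.

Lemma cross_suml (I : Type) (r : seq I) (P : pred I) (F : I -> R * R) w :
  cross (\sum_(i <- r | P i) F i) w = \sum_(i <- r | P i) cross (F i) w.
Proof.
have c0 : cross 0 w = 0 by rewrite /cross/= !mul0r subrr.
exact: (big_morph (fun v => cross v w) (fun u v => crossDl u v w) c0).
Qed.

Lemma is_derive_edge (n : bipoly R) (i : 'I_3) t :
  is_derive t 1 (fun s => ev n (edge_par i s))
    (cross (Rgrad n (edge_par i t)) (edge_tangent R i)).
Proof.
have := is_derive_ev n (vtx R (edge_src i)) (edge_tangent R i) t.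
congr (is_derive _ _ _ _); rewrite /cross /Rgrad /edge_par/=; ring.
Qed.

Lemma Rgrad_edge_eq0 (n : bipoly R) (i : 'I_3) t : t \in `[0, 1] ->
  (forall x, edge i x -> ev n x = 0) ->
  cross (Rgrad n (edge_par i t)) (edge_tangent R i) = 0.
Proof.
move=> t01 n0; apply: (is_derive_eq_unit t01 _ (is_derive_edge n i t)
  (is_derive_cst (0 : R) t 1)) => s s01.
by apply: n0; exists s.
Qed.

Lemma phiI_trace (i j : 'I_3) t :
  cross (@phiI R j (edge_par i t)) (edge_tangent R i) = (i == j)%:R.
Proof.
move: i j; apply: ord3_cases; apply: ord3_cases;
rewrite ?edge_par0 ?edge_par1 ?edge_par2 ?edge_tangent0 ?edge_tangent1 ?edge_tangent2
  /phiI (tnth_nth (@phi1 R))/= /phi1 /phi2 /phi3 /cross/=; ring.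
Qed.

Section Element.
Variables (p : nat) (U : h1_family R p) (W : h1_family R p.+1).
Hypotheses (hU : h1_polytopal U) (hW : h1_polytopal W).

(** In a tensor product, on each edge either the scalar factor vanishes or the vector factor is
    tangential. [T_vert] is the position relative to its vertex, tangential to both edges through
    it; [T_edge] is the sum of the positions relative to the two end points of its edge, tangential
    to that edge. A cell curl has a potential that is constant along every edge. *)
Lemma RT_cell_trace k (i : 'I_3) t : t \in `[0, 1] ->
  cross (RT_cell U W k (edge_par i t)) (edge_tangent R i) = 0.
Proof.
move=> t01; have ei : edge i (edge_par i t) by exists t.
have [_ Uv Ue Uc] := hU; have [_ _ _ Wc] := hW.
case: k => [k|[k|[[j k]|k]]] /=; rewrite ?crossZl.
- by apply: Rgrad_edge_eq0 => // x; exact: Wc.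
- have [io|/norP[/= ns nt]] := boolP ((widen_ord (isT : (2 <= 3)%N) k == edge_src i)
     || (widen_ord (isT : (2 <= 3)%N) k == edge_tgt i)); last first.
    by rewrite (Uv _ i)// mul0r.
  suff -> : cross (@T_vert R k (edge_par i t)) (edge_tangent R i) = 0 by rewrite mulr0.
  move: io {ei}; move: i; apply: ord3_cases; case: k => [[|[|//]] ltk];
  rewrite /edge_src /edge_tgt !(tnth_nth ord0)/= ?edge_par0 ?edge_par1 ?edge_par2
    ?edge_tangent0 ?edge_tangent1 ?edge_tangent2
    /T_vert (tnth_nth (@phi1 R))/= /phi1 /phi2 /phi3 /cross/= ?fctE/= => // _; ring.
- have [->|ji] := eqVneq j i; last by rewrite (Ue _ _ i)// ?mul0r// eq_sym.
  suff -> : cross (@T_edge R i (edge_par i t)) (edge_tangent R i) = 0 by rewrite mulr0.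
  move: i {ei}; apply: ord3_cases;
  rewrite ?edge_par0 ?edge_par1 ?edge_par2 ?edge_tangent0 ?edge_tangent1 ?edge_tangent2
    /T_edge (tnth_nth (@phi1 R))/= /phi1 /phi2 /phi3 /cross/= ?fctE/=; ring.
- by rewrite (Uc _ i)// mul0r.
Qed.

(** The common potential of all edge curls. With zero vertex coefficients, compatibility of the edge
    coefficients is all that [h1_continuous] asks for. *)
Definition edge_part (ce : 'I_3 -> option 'I_p -> R) : bipoly R :=
  h1_comb W (fun=> 0) (fun j k => ce j (Some k)) (fun=> 0).

Lemma RgradD m n x : Rgrad (m + n) x = Rgrad m x + Rgrad n x.
Proof. by rewrite /Rgrad /dxi /deta !raddfD/= !evD; congr pair; rewrite /= opprD. Qed.

Lemma RgradZ c n x : Rgrad (c%:P *: n) x = c *: Rgrad n x.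
Proof.
have E : dxi (c%:P *: n) = c%:P *: dxi n.
  apply/polyP => i; rewrite /dxi coef_map !coefZ coef_map/=.
  by rewrite derivM derivC mul0r add0r.
by rewrite /Rgrad E /deta derivZ !evZ; congr pair; rewrite /GRing.scale/= mulrN.
Qed.

Lemma Rgrad_sum (I : Type) (r : seq I) (P : pred I) (F : I -> bipoly R) x :
  Rgrad (\sum_(i <- r | P i) F i) x = \sum_(i <- r | P i) Rgrad (F i) x.
Proof.
have R0 : Rgrad 0 x = 0.
  by rewrite /Rgrad /dxi /deta map_poly0 deriv0 /ev !horner0 oppr0.
exact: (big_morph (fun n => Rgrad n x) (fun m n => RgradD m n x) R0).
Qed.

Lemma sum_option (V : nmodType) (T : finType) (F : option T -> V) :
  \sum_k F k = F None + \sum_k F (Some k).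
Proof.
rewrite (bigD1 None)//=; congr (_ + _).
rewrite (reindex_omap Some id)//=; last by case.
by apply: eq_bigl => k; rewrite eqxx.
Qed.

Lemma Rgrad_edge_part ce x :
  Rgrad (edge_part ce) x = \sum_j \sum_k ce j (Some k) *: Rgrad (edgef W j k) x.
Proof.
rewrite /edge_part /h1_comb !RgradD !Rgrad_sum.
under [X in X + _ + _]eq_bigr => i _ do rewrite RgradZ scale0r.
under [X in _ + _ + X]eq_bigr => i _ do rewrite RgradZ scale0r.
rewrite !big1_eq add0r addr0; apply: eq_bigr => j _.
by rewrite Rgrad_sum; apply: eq_bigr => k _; rewrite RgradZ.
Qed.

Lemma v_comb_split (ce : 'I_3 -> option 'I_p -> R) cc x :
  v_comb (F := RT U W) ce cc x = \sum_j ce j None *: @phiI R j x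
    + Rgrad (edge_part ce) x + \sum_k cc k *: RT_cell U W k x.
Proof.
rewrite /v_comb/= Rgrad_edge_part -big_split/=; congr (_ + _).
by apply: eq_bigr => j _; rewrite sum_option.
Qed.

Lemma v_comb_trace (ce : 'I_3 -> option 'I_p -> R) cc (i : 'I_3) t : t \in `[0, 1] ->
  cross (v_comb (F := RT U W) ce cc (edge_par i t)) (edge_tangent R i)
  = ce i None + cross (Rgrad (edge_part ce) (edge_par i t)) (edge_tangent R i).
Proof.
move=> t01; rewrite v_comb_split !crossDl !cross_suml.
rewrite [X in _ + X]big1 => [|k _]; last by rewrite crossZl RT_cell_trace// mulr0.
rewrite addr0; congr (_ + _); rewrite (bigD1 i)//= big1 => [|j ji].
  by rewrite crossZl phiI_trace eqxx mulr1 addr0.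
by rewrite crossZl phiI_trace eq_sym (negPf ji) mulr0.
Qed.

(** No sign correction occurs, because both tangents follow the common parametrisation of the
    interface. The potentials agree along the whole edge, hence so do their derivatives in the
    parameter. *)
Lemma v_comb_trace_interface (M : mesh R) (ce : elt M -> 'I_3 -> option 'I_p -> R)
    cc e i e' j t :
  h1_continuous W -> v_compatible (F := RT U W) ce -> interface e i e' j ->
  t \in `[0, 1] ->
  cross (v_comb (F := RT U W) (ce e) (cc e) (edge_par i t)) (edge_tangent R i)
  = cross (v_comb (F := RT U W) (ce e') (cc e') (edge_par j t)) (edge_tangent R j).
Proof.
move=> Wcont cec int t01; rewrite !v_comb_trace// (cec _ _ _ _ int); congr (_ + _).
apply: (is_derive_eq_unit t01 _ (is_derive_edge _ i t) (is_derive_edge _ j t)) => s s01.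
apply: (Wcont M (fun _ _ => 0) (fun e j k => ce e j (Some k)) (fun _ _ => 0)) => //.
split => // e1 e2 i1 i2 int'; apply/funext => k.
by rewrite (cec _ _ _ _ int').
Qed.

End Element.
End EdgeTraces.

(** * Piola maps and the normal jump *)

Section NormalJump.
Context {R : realType}.
Implicit Types (X : R * R -> R * R) (x u v w : R * R) (t : R).

Lemma edge_par_Gam (i : 'I_3) t : t \in `[0, 1] -> Gam R (edge_par i t).
Proof.
rewrite in_itv/= => /andP[t0 t1].
move: i; apply: ord3_cases; rewrite ?edge_par0 ?edge_par1 ?edge_par2;
  split => /=; lra.
Qed.

Lemma edge_tangent_neq0 (i : 'I_3) : edge_tangent R i != 0.
Proof.
move: i; apply: ord3_cases; rewrite ?edge_tangent0 ?edge_tangent1 ?edge_tangent2;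
by apply/eqP => -[] /eqP; rewrite oner_eq0 // => _ /eqP; rewrite oner_eq0.
Qed.

Lemma dot_self_eq0 u : (dot u u == 0) = (u == 0).
Proof.
apply/eqP/eqP => [|->]; last by rewrite /dot/= mul0r addr0.
case: u => u1 u2; rewrite /dot/= -!expr2 => /eqP.
by rewrite paddr_eq0 ?sqr_ge0// !sqrf_eq0 => /andP[/eqP-> /eqP->].
Qed.

Lemma diff_pairE (V : normedModType R) (X : R * R -> V) x v :
  'd X x v = v.1 *: 'd X x (1, 0) + v.2 *: 'd X x (0, 1).
Proof.
rewrite -!linearZ -linearD; congr ('d X x _).
by case: v => v1 v2; congr pair; rewrite /= /GRing.scale/= ?mulr1 ?mulr0 ?addr0 ?add0r.
Qed.

Lemma cross_diff X x u v :
  cross ('d X x u) ('d X x v) = jac_det X x * cross u v.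
Proof.
by rewrite (diff_pairE X x u) (diff_pairE X x v) /jac_det /cross/= /GRing.scale/=; ring.
Qed.

Lemma cross_piola X (phi : R * R -> R * R) x v : jac_det X x != 0 ->
  cross (piola X phi x) ('d X x v) = cross (phi x) v.
Proof. by move=> d0; rewrite /piola crossZl cross_diff mulKf. Qed.

(** Crossing with the image of the rotated vector [(v.2, - v.1)] yields the determinant times the
    squared length of [v], which would vanish with the image of [v]. *)
Lemma diff_neq0 X x v : jac_det X x != 0 -> v != 0 -> 'd X x v != 0.
Proof.
move=> d0; apply: contraNneq => dv0; rewrite -dot_self_eq0.
have := cross_diff X x (v.2, - v.1) v; rewrite dv0 {1}/cross !mulr0 subrr.
by move/esym/eqP; rewrite mulf_eq0 (negPf d0)/= /cross/= mulNr opprK addrC.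
Qed.

Lemma is_derive_line (V : normedModType R) (X : R * R -> V) x v t : differentiable X (x + t *: v) ->
  is_derive t 1 (fun s => X (x + s *: v)) ('d X (x + t *: v) v).
Proof.
move=> dX; have dv := diff_derivable (v := v) dX.
have E : (fun h : R => h^-1 *: ((X \o shift (x + t *: v)) (h *: v) - X (x + t *: v))) =
  (fun h : R => h^-1 *: (((fun s : R => X (x + s *: v)) \o shift t) (h *: 1)
     - (fun s : R => X (x + s *: v)) t)).
  apply/funext => h /=; congr (_ *: (X _ - _)).
  by rewrite [in RHS]scalerDl -[h *: 1]/(h * 1) mulr1 addrCA.
apply: DeriveDef; first by rewrite /derivable -E.
by rewrite -(deriveE _ dX) /derive -E.
Qed.

(** For [n] normal to [u] the first term drops out, so the normal component of [w] is determined by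
    its cross product with [u]. This turns equality of cross products into equality of normal
    traces. *)
Lemma dot_crossE n w u : dot u u * dot n w = dot n u * dot w u + cross n u * cross w u.
Proof. by rewrite /dot /cross; ring. Qed.

Lemma interface_diff_tangent (M : mesh R) (e e' : elt M) i j t :
  interface e i e' j -> t \in `[0, 1] ->
  'd (emap e) (edge_par i t) (edge_tangent R i)
  = 'd (emap e') (edge_par j t) (edge_tangent R j).
Proof.
move=> [ee' eij] t01.
have dX (e0 : elt M) (i0 : 'I_3) : is_derive t 1 (fun s => emap e0 (edge_par i0 s))
    ('d (emap e0) (edge_par i0 t) (edge_tangent R i0)).
  apply: is_derive_line.
  exact: nbhs_singleton (emap_diff e0 (edge_par_Gam i0 t01)).
exact: is_derive_eq_unit t01 (mesh_order ee' eij) (dX e i) (dX e' j).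
Qed.

Lemma RT_no_normal_jump (p : nat) (U : h1_family R p) (W : h1_family R p.+1)
    (M : mesh R) (ce : elt M -> 'I_3 -> option 'I_p -> R) cc :
  h1_polytopal U -> h1_polytopal W -> h1_continuous W ->
  v_compatible (F := RT U W) ce -> no_normal_jump (F := RT U W) ce cc.
Proof.
move=> hU hW cW cec e i e' j int t t01 n.
have tan := interface_diff_tangent int t01.
have [Ge Ge'] := (edge_par_Gam i t01, edge_par_Gam j t01).
have T0 := diff_neq0 (emap_reg e Ge) (edge_tangent_neq0 i).
rewrite -dot_self_eq0 in T0 => nT.
apply: (mulfI T0); rewrite !dot_crossE nT !mul0r !add0r; congr (_ * _).
rewrite (cross_piola _ _ (emap_reg e Ge)) tan (cross_piola _ _ (emap_reg e' Ge')).
exact: v_comb_trace_interface.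
Qed.

End NormalJump.

(** * Affine triangulations *)

Section AffineMaps.
Context {R : realType}.
Implicit Types (a b c u v w x : R * R).

(** Cramer's rule. *)
Definition affine2_inv a b c x : R * R :=
  (cross (x - a) c / cross b c, cross b (x - a) / cross b c).

Lemma affine2E a b c x : affine2 a b c x =
  (a.1 + x.1 * b.1 + x.2 * c.1, a.2 + x.1 * b.2 + x.2 * c.2).
Proof. by []. Qed.

Lemma affine2K a b c : cross b c != 0 -> cancel (affine2 a b c) (affine2_inv a b c).
Proof.
case: a b c => [a1 a2] [b1 b2] [c1 c2]; rewrite /cross/= => d0 [x y].
by rewrite affine2E /affine2_inv /cross/=; congr pair; rewrite /=; field.
Qed.

Lemma affine2_invK a b c : cross b c != 0 -> cancel (affine2_inv a b c) (affine2 a b c).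
Proof.
case: a b c => [a1 a2] [b1 b2] [c1 c2]; rewrite /cross/= => d0 [x y].
by rewrite affine2E /affine2_inv /cross/=; congr pair; rewrite /=; field.
Qed.

Lemma continuous_affine_form (r s t : R) : continuous (fun x : R * R => r + x.1 * s + x.2 * t).
Proof.
move=> x; apply: cvgD; last by apply: cvgM; [exact: cvg_snd|exact: cvg_cst].
by apply: cvgD; [exact: cvg_cst|apply: cvgM; [exact: cvg_fst|exact: cvg_cst]].
Qed.

Lemma continuous_affine2 a b c : continuous (affine2 a b c).
Proof. by apply: continuous_pair; exact: continuous_affine_form. Qed.

Lemma continuous_affine2_inv a b c : continuous (affine2_inv a b c).
Proof.
rewrite (_ : affine2_inv a b c = affine2 (- cross a c / cross b c, - cross b a / cross b c)
  (c.2 / cross b c, - b.2 / cross b c) (- c.1 / cross b c, b.1 / cross b c)).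
  exact: continuous_affine2.
by apply/funext => x; rewrite affine2E /affine2_inv /cross/=; congr pair; ring.
Qed.

Lemma affine2_add a b c x v : affine2 a b c (x + v) = affine2 a b c x + (v.1 *: b + v.2 *: c).
Proof. by rewrite /affine2 !scalerDl; ring. Qed.

Lemma jac_det_cross (X : R * R -> R * R) x :
  jac_det X x = cross ('d X x (1, 0)) ('d X x (0, 1)).
Proof. by rewrite /jac_det /cross; congr (_ - _); exact: mulrC. Qed.

Lemma is_derive_affine_line (V : normedModType R) (p w : V) (t : R) :
  is_derive t 1 (fun s : R => p + s *: w) w.
Proof.
have cv : (fun h => h^-1 *: (((fun s : R => p + s *: w) \o shift t) (h *: 1)
    - (p + t *: w))) @ 0^' --> w.
  apply: cvg_near_cst; near=> h; have h0 : h != 0 by near: h; exact: nbhs_dnbhs_neq.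
  rewrite /= -[h *: 1]/(h * 1) mulr1 scalerDl opprD addrACA subrr add0r addrK.
  by rewrite scalerA mulVf// scale1r.
apply: DeriveDef; first by apply/cvg_ex; exists w.
exact: cvg_lim cv.
Unshelve. all: by end_near. Qed.

(** The differential is read off from the derivative along the line through [x] in direction [v], on
    which [X] is explicitly affine. *)
Lemma diff_affine2 (X : R * R -> R * R) a b c x v :
  X = affine2 a b c -> differentiable X x -> 'd X x v = v.1 *: b + v.2 *: c.
Proof.
move=> XE dX.
have d1 : is_derive (0 : R) 1 (fun s : R => X (x + s *: v)) ('d X x v).
  have := @is_derive_line _ _ X x v 0.
  by rewrite scale0r addr0; apply.
have d2 := is_derive_affine_line (X x) (v.1 *: b + v.2 *: c) 0.
have E : (fun s : R => X (x + s *: v)) =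
    (fun s => X x + s *: (v.1 *: b + v.2 *: c)).
  by apply/funext => s; rewrite XE affine2_add/= -!scalerA -scalerDr.
by rewrite E in d1; case: d1 => _ <-; case: d2.
Qed.

End AffineMaps.

(** * Sides, orientation and incidence of the reference edges *)

Section ReferenceGeometry.
Context {R : realType}.
Implicit Types (u v w x : R * R) (t : R) (i j k : 'I_3).

Lemma same_sign (r s t : R) : r * s < 0 -> 0 < r * t -> t * s < 0.
Proof.
have [r0|r0|->] := ltgtP r 0; last by rewrite mul0r ltxx.
  by rewrite nmulr_rlt0// nmulr_rgt0// => s0 t0; rewrite nmulr_rlt0.
by rewrite pmulr_rlt0// pmulr_rgt0// => s0 t0; rewrite pmulr_rlt0.
Qed.

(** The quotient of [|d|] by [d] is the sign of [d]. The two compared quantities are the orientation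
    factors of the fluxes through the two sides of an interface. *)
Lemma opposite_signs (s s' d d' : R) : s = 1 \/ s = -1 -> s' = 1 \/ s' = -1 ->
  d != 0 -> d' != 0 -> s * s' * (d * d') < 0 -> `|d'| / d' * s' = - (`|d| / d * s).
Proof.
have sg (r : R) : r != 0 ->
    (`|r| / r = 1 /\ r = `|r|) \/ (`|r| / r = -1 /\ r = - `|r|).
  move=> r0; have [r_lt0|r_gt0|r00] := ltgtP r 0; last by rewrite r00 eqxx in r0.
    by right; rewrite ltr0_norm// mulNr divff// opprK.
  by left; rewrite gtr0_norm// divff.
move=> hs hs' d0 d'0; have pos : 0 < `|d| * `|d'| by rewrite mulr_gt0 ?normr_gt0.
case: (sg _ d0) (sg _ d'0) hs hs' => -[-> E] [] [-> E'] [] -> [] ->;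
rewrite [X in _ * (X * _)]E [X in _ * (_ * X)]E'; move: pos;
lra.
Qed.

Lemma exists_cross_lt0 (c : R) v : c != 0 -> v != 0 -> exists w, c * cross w v < 0.
Proof.
move=> c0 v0; exists (- c *: (v.2, - v.1)).
rewrite (_ : _ * _ = - (c ^+ 2 * dot v v)); last first.
  by rewrite /cross /dot/= /GRing.scale/=; ring.
rewrite oppr_lt0 mulr_gt0 ?exprn_even_gt0// lt_neqAle eq_sym dot_self_eq0 v0/=.
by rewrite /dot addr_ge0// -expr2 sqr_ge0.
Qed.

Lemma edge_signP i : edge_sign i = 1 :> R \/ edge_sign i = -1 :> R.
Proof.
by move: i; apply: ord3_cases; rewrite /edge_sign (tnth_nth 0)/=; [right|left|right].
Qed.

Lemma edge_sign_neq0 i : edge_sign i != 0 :> R.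
Proof.
by move: i; apply: ord3_cases; rewrite /edge_sign (tnth_nth 0)/= ?oppr_eq0 oner_eq0.
Qed.

(** The signed cross product measures the outward displacement from the line of edge [i]. *)
Lemma Gam_edge_side i t x : Gam R x ->
  edge_sign i * cross (x - edge_par i t) (edge_tangent R i) <= 0.
Proof.
move: i; apply: ord3_cases; rewrite ?edge_par0 ?edge_par1 ?edge_par2
  ?edge_tangent0 ?edge_tangent1 ?edge_tangent2 /edge_sign (tnth_nth 0)/= /cross/=
  => -[? ? ?]; lra.
Qed.

Lemma Gam_inward i v : edge_sign i * cross v (edge_tangent R i) < 0 ->
  exists2 s0 : R, 0 < s0 & forall s, 0 < s <= s0 -> Gam R (edge_par i 2^-1 + s *: v).
Proof.
case: v => v1 v2 h.
pose K := `|v1| + `|v2| + 1.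
have K0 : 0 < K by rewrite /K ltr_wpDl// addr_ge0.
(* The displacement is then at most 1/4 in each coordinate, while the two constraints that are not
   active at the midpoint have slack 1/2 there. *)
exists (4 * K)^-1; first by rewrite invr_gt0 mulr_gt0.
move=> s /andP[s0 sK].
have sle r : `|r| <= K -> `|s * r| <= 4^-1.
  move=> rK; rewrite normrM gtr0_norm//.
  apply: (@le_trans _ _ ((4 * K)^-1 * K)); first by apply: ler_pM => //; exact: ltW.
  by rewrite invfM -mulrA mulVf ?mulr1// gt_eqF.
have s1 : `|s * v1| <= 4^-1.
  by apply: sle; rewrite /K -addrA lerDl addr_ge0.
have s2 : `|s * v2| <= 4^-1.
  by apply: sle; rewrite /K addrAC lerDr addr_ge0.
have hs : s * (edge_sign i * cross (v1, v2) (edge_tangent R i)) < 0.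
  by rewrite pmulr_rlt0.
clear h; move: s1 s2 hs; rewrite !ler_norml => /andP[? ?] /andP[? ?].
move: i; apply: ord3_cases; rewrite ?edge_par0 ?edge_par1 ?edge_par2
  ?edge_tangent0 ?edge_tangent1 ?edge_tangent2 /edge_sign (tnth_nth 0)/= /cross/=
  => hs; split; rewrite /= /GRing.scale/=; lra.
Qed.

Lemma vtx_edge i : exists k, edge k (vtx R i).
Proof.
move: i; apply: ord3_cases.
- exists (@Ordinal 3 0 isT); exists 0; first by rewrite /= in_itv/= lexx ler01.
  by rewrite edge_par0 /vtx (tnth_nth 0).
- exists (@Ordinal 3 0 isT); exists 1; first by rewrite /= in_itv/= lexx ler01.
  by rewrite edge_par0 /vtx (tnth_nth 0).
- exists (@Ordinal 3 1 isT); exists 1; first by rewrite /= in_itv/= lexx ler01.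
  by rewrite edge_par1 /vtx (tnth_nth 0).
Qed.

Lemma edge_collinear k u v w : edge k u -> edge k v -> edge k w ->
  cross (v - u) (w - u) = 0.
Proof.
move=> [r _ <-] [s _ <-] [t _ <-].
by rewrite /edge_par /cross/= /GRing.scale/=; ring.
Qed.

Lemma edge_par_in i t : t \in `[0, 1] -> edge i (@edge_par R i t).
Proof. by move=> t01; exists t. Qed.

Lemma edge_par_relint i k t : 0 < t < 1 -> edge k (edge_par i t) -> k = i.
Proof.
move=> /andP[t0 t1] [s +]; rewrite /= in_itv/= => /andP[s0 s1].
move: i k; apply: ord3_cases; apply: ord3_cases;
rewrite ?edge_par0 ?edge_par1 ?edge_par2 => -[] => // *; exfalso; lra.
Qed.

Lemma edge_inj i j : edge i = edge j :> set (R * R) -> i = j.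
Proof.
move=> ij; apply: (@edge_par_relint j i 2^-1); first by lra.
by rewrite ij; apply: edge_par_in; rewrite in_itv/=; lra.
Qed.

Lemma relint_not_vtx i j t : 0 < t < 1 -> edge_par i t <> vtx R j.
Proof.
move=> /andP[t0 t1]; move: i j; apply: ord3_cases; apply: ord3_cases;
rewrite ?edge_par0 ?edge_par1 ?edge_par2 /vtx (tnth_nth 0)/= => -[] *; lra.
Qed.

Lemma compact_Gam : compact (Gam R).
Proof.
apply: (subclosed_compact _ (@compact_square R) (@Gam_square R)).
have cD : continuous (fun z : R * R => z.1 + z.2).
  by move=> z; apply: cvgD; [exact: cvg_fst|exact: cvg_snd].
have -> : Gam R = fst @^-1` [set x | 0 <= x] `&` (snd @^-1` [set x | 0 <= x]
    `&` (fun z : R * R => z.1 + z.2) @^-1` [set x | x <= 1]).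
  by apply/seteqP; split => z [] //= ? []; split.
apply: closedI; last apply: closedI.
- by apply: closed_comp (@closed_ge R 0) => z _; exact: cvg_fst.
- by apply: closed_comp (@closed_ge R 0) => z _; exact: cvg_snd.
- by apply: closed_comp (@closed_le R 1) => z _; exact: cD.
Qed.

End ReferenceGeometry.

(* Locked because conversion must not unfold the differentials, which are
   defined by choice. *)
HB.lock Definition elin (R : realType) (M : mesh R) (e : elt M) (v : R * R) : R * R :=
  'd (emap e) (0, 0) v.
HB.lock Definition edet (R : realType) (M : mesh R) (e : elt M) : R :=
  jac_det (emap e) (0, 0).

(** * Neighbouring elements of an affine triangulation *)

Section AffineMeshes.
Context {R : realType}.
Variables (M : mesh R) (affM : affine_mesh M).
Implicit Types (u v w x y : R * R) (t : R) (i j k : 'I_3) (e : elt M).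

(** An inverse on the whole plane, whereas the ['pinv] of [v_assembled] is controlled only on the
    image of [Gam R]; [assembledE] replaces the latter by the former. *)
Definition einv e : R * R -> R * R :=
  affine2_inv (emap e (0, 0)) (elin e (1, 0)) (elin e (0, 1)).

Lemma Gam0 : Gam R (0, 0).
Proof. by split => /=; rewrite ?addr0 ?lexx ?ler01. Qed.

Lemma edet_neq0 e : edet e != 0.
Proof. by rewrite edet.unlock; exact: emap_reg Gam0. Qed.

Lemma edetE e : edet e = cross (elin e (1, 0)) (elin e (0, 1)).
Proof. by rewrite edet.unlock elin.unlock; exact: jac_det_cross. Qed.

Lemma elinE e v : elin e v = v.1 *: elin e (1, 0) + v.2 *: elin e (0, 1).
Proof. by rewrite elin.unlock; exact: diff_pairE. Qed.

Lemma elinZ e (s : R) v : elin e (s *: v) = s *: elin e v.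
Proof. by rewrite elin.unlock; exact: linearZ. Qed.

Lemma emap_differentiable e x : Gam R x -> differentiable (emap e) x.
Proof. by move=> Gx; exact: nbhs_singleton (emap_diff e Gx). Qed.

Lemma emap_diffE e x v : Gam R x -> 'd (emap e) x v = elin e v.
Proof.
move=> Gx; have [a [b [c /funext X]]] := affM e; rewrite elin.unlock.
exact: etrans (diff_affine2 v X (emap_differentiable e Gx))
  (esym (diff_affine2 v X (emap_differentiable e Gam0))).
Qed.

Lemma emap_affine2 e :
  emap e = affine2 (emap e (0, 0)) (elin e (1, 0)) (elin e (0, 1)).
Proof.
have [a [b [c /funext X]]] := affM e.
have E v : elin e v = v.1 *: b + v.2 *: c.
  by rewrite elin.unlock; exact: diff_affine2 v X (emap_differentiable e Gam0).
rewrite !E X; apply/funext => z.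
by rewrite /affine2/= !scale1r !scale0r !addr0 add0r.
Qed.

Lemma emap_add e x v : emap e (x + v) = emap e x + elin e v.
Proof. by rewrite {1 2}emap_affine2 affine2_add (elinE e v). Qed.

Lemma jac_detE e x : Gam R x -> jac_det (emap e) x = edet e.
Proof.
move=> Gx; rewrite edetE jac_det_cross.
exact: congr2 (emap_diffE e (1, 0) Gx) (emap_diffE e (0, 1) Gx).
Qed.

Lemma emapK e : cancel (emap e) (einv e).
Proof.
by move=> x; rewrite emap_affine2 /einv affine2K// -edetE edet_neq0.
Qed.

Lemma einvK e : cancel (einv e) (emap e).
Proof. by move=> x; rewrite {1}emap_affine2 /einv affine2_invK// -edetE edet_neq0. Qed.

Lemma cross_elin e u v : cross (elin e u) (elin e v) = edet e * cross u v.
Proof. by rewrite elin.unlock edet.unlock; exact: cross_diff. Qed.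

Lemma elin_surj e w : exists v, elin e v = w.
Proof.
exists (einv e (emap e (0, 0) + w)); apply: (addrI (emap e (0, 0))).
rewrite -emap_add; exact: etrans (congr1 (emap e) (add0r _)) (einvK e _).
Qed.

Lemma elin_neq0 e v : v != 0 -> elin e v != 0.
Proof.
rewrite elin.unlock; apply: diff_neq0.
by have := edet_neq0 e; rewrite edet.unlock.
Qed.

Lemma closed_element e : closed (element e).
Proof.
apply: compact_closed; first exact: norm_hausdorff.
apply: continuous_compact; last exact: compact_Gam.
by apply: continuous_subspaceT; rewrite emap_affine2; exact: continuous_affine2.
Qed.

(** The three cases of conformity are merged: the contact lies in a single edge of [e]. If it is a
    vertex, any edge through it serves; if it is empty, any edge does. *)
Lemma element_capE e e' : e != e' ->
  exists k, forall x, Gam R x -> element e' (emap e x) -> edge k x.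
Proof.
move=> ee'; have inE x : Gam R x -> element e' (emap e x) ->
    (emap e @` Gam R `&` emap e' @` Gam R) (emap e x).
  by move=> Gx ?; split => //; exists x.
case: (mesh_conforming ee') => [E|[i [j [E _]]]|[i [j [E _]]]].
- by exists ord0 => x Gx /(inE _ Gx); rewrite E.
- have [k vk] := vtx_edge (R := R) i.
  by exists k => x Gx /(inE _ Gx); rewrite E => /(can_inj (emapK e)) ->.
- exists i => x Gx /(inE _ Gx); rewrite E => -[z iz /(can_inj (emapK e)) <- //].
Qed.

Lemma interface_sym e i e' j : interface e i e' j -> interface e' j e i.
Proof. by move=> [ee' E]; split; [rewrite eq_sym|]. Qed.

Lemma interface_tangent e i e' j : interface e i e' j ->
  elin e (edge_tangent R i) = elin e' (edge_tangent R j).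
Proof.
move=> int; have t0 : (0 : R) \in `[0, 1] by rewrite in_itv/= lexx ler01.
have Gi k := edge_par_Gam k t0.
have D1 := emap_diffE e (edge_tangent R i) (Gi i).
have D2 := emap_diffE e' (edge_tangent R j) (Gi j).
exact: etrans (esym D1) (etrans (interface_diff_tangent int t0) D2).
Qed.

Lemma interface_point e i e' j t : interface e i e' j -> t \in `[0, 1] ->
  emap e (edge_par i t) = emap e' (edge_par j t).
Proof. by move=> [ee' E]; exact: mesh_order. Qed.

(* Were both elements on the same side of the edge, the points pushed inwards
   from its midpoint would lie in both of them, hence on one common edge. *)
Lemma interface_orientation e i e' j : interface e i e' j ->
  (edge_sign i * edge_sign j) * (edet e * edet e') < 0.
Proof.
move=> int; have tan := interface_tangent int.
rewrite lt_neqAle !mulf_neq0 ?edge_sign_neq0 ?edet_neq0//= leNgt; apply/negP => pos.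
have T0 : elin e (edge_tangent R i) != 0 by rewrite elin_neq0 ?edge_tangent_neq0.
(* The direction [w] is chosen in the physical plane, so that under the assumed signs its preimages
   under both linear parts point into the reference triangle. *)
have [w hw] := exists_cross_lt0 (mulf_neq0 (edge_sign_neq0 i) (edet_neq0 e)) T0.
have inw (e0 : elt M) k v : elin e0 v = w ->
    elin e0 (edge_tangent R k) = elin e (edge_tangent R i) ->
    0 < edge_sign i * edge_sign k * (edet e * edet e0) ->
    edge_sign k * cross v (edge_tangent R k) < 0.
  move=> vw Tk posk; move: hw; rewrite -vw -Tk cross_elin mulrA.
  move/same_sign; apply; suff -> : edge_sign i * edet e * edet e0 * edge_sign k =
    edge_sign i * edge_sign k * (edet e * edet e0) by [].
  by rewrite -!mulrA; congr (_ * _); rewrite mulrA mulrC.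
have [v vw] := elin_surj e w; have [v' vw'] := elin_surj e' w.
have pos1 : 0 < edge_sign i * edge_sign i * (edet e * edet e).
  by rewrite -!expr2 mulr_gt0// exprn_even_gt0//= ?edge_sign_neq0 ?edet_neq0.
have hv := inw e i v vw erefl pos1.
have hv' := inw e' j v' vw' (esym tan) pos.
have [s s0 Gs] := Gam_inward hv; have [s' s0' Gs'] := Gam_inward hv'.
pose r := Num.min s s'; have r0 : 0 < r by rewrite lt_min s0.
have mid : 2^-1 \in `[0 : R, 1] by rewrite in_itv/=; lra.
have end0 : 0 \in `[0 : R, 1] by rewrite in_itv/= lexx ler01.
have end1 : 1 \in `[0 : R, 1] by rewrite in_itv/= lexx ler01.
have [k kP] := element_capE (proj1 int).
have kpar t : t \in `[0, 1] -> edge k (edge_par i t).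
  move=> t01; apply: kP; first exact: edge_par_Gam.
  by rewrite (interface_point int)//; exists (edge_par j t) => //; exact: edge_par_Gam.
have kr : edge k (edge_par i 2^-1 + r *: v).
  apply: kP; first by apply: Gs; rewrite r0 ge_min lexx.
  exists (edge_par j 2^-1 + r *: v'); first by apply: Gs'; rewrite r0 ge_min lexx orbT.
  by rewrite (emap_add e' (edge_par j 2^-1)) (emap_add e (edge_par i 2^-1))
    (interface_point int mid) !elinZ vw vw'.
(* One edge would contain both end points of edge [i] and the point pushed off it, so [v] would be
   parallel to the tangent. *)
have := edge_collinear (kpar _ end0) (kpar _ end1) kr.
rewrite (_ : cross _ _ = - r * cross v (edge_tangent R i)); last first.
  by rewrite /edge_par /cross/= /GRing.scale/=; ring.
move/eqP; rewrite mulf_eq0 oppr_eq0 gt_eqF//= => /eqP cv0.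
by move: hv; rewrite cv0 mulr0 ltxx.
Qed.

(** Two distinct neighbours at one edge would form an interface with each other. The three pairwise
    orientation products are negative, but their product is a square. With a single neighbour,
    injectivity of its map identifies the edges. *)
Lemma interface_unique e i e1 j1 e2 j2 :
  interface e i e1 j1 -> interface e i e2 j2 -> (e1, j1) = (e2, j2).
Proof.
move=> int1 int2; have [E1 E2] := (proj2 int1, proj2 int2).
have [e12|e12] := eqVneq e1 e2.
  rewrite -e12 in E2 *; congr pair; apply: (@edge_inj R).
  have : emap e1 @` edge j1 = emap e1 @` edge j2 by rewrite -E1 -E2.
  move=> J; apply/seteqP; split => z jz.
    have : (emap e1 @` edge j2) (emap e1 z) by rewrite -J; exists z.
    by move=> [y jy /(can_inj (emapK e1)) <-].
  have : (emap e1 @` edge j1) (emap e1 z) by rewrite J; exists z.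
  by move=> [y jy /(can_inj (emapK e1)) <-].
have int12 : interface e1 j1 e2 j2 by split => //; rewrite -E1 -E2.
have o1 := interface_orientation int1; have o2 := interface_orientation int2.
have o12 := interface_orientation int12.
have : edge_sign i * edge_sign j1 * (edet e * edet e1) *
    (edge_sign j1 * edge_sign j2 * (edet e1 * edet e2)) *
    (edge_sign i * edge_sign j2 * (edet e * edet e2)) < 0.
  by rewrite pmulr_rlt0// nmulr_rgt0.
move: (edge_sign i) (edge_sign j1) (edge_sign j2) (edet e) (edet e1) (edet e2).
move=> a b c d d1 d2.
rewrite (_ : _ * _ = (a * b * c * (d * d1 * d2)) ^+ 2); last by ring.
by rewrite ltNge sqr_ge0.
Qed.

(** If no other element contained the point, then, the finite union of the others being closed, [e]
    alone would cover a neighbourhood, which fails just outside the edge. An element that does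
    contain it meets [e] at a point that is no vertex and is on no other edge, hence along edge
    [i]. *)
Lemma interior_edge_interface e i t : 0 < t < 1 ->
  (domain M)^° (emap e (edge_par i t)) -> exists e' j, interface e i e' j.
Proof.
move=> t01; set y := emap e _ => yint.
have t01' : t \in `[0, 1] by rewrite in_itv/=; case/andP: t01; lra.
have Gy := edge_par_Gam i t01'.
suff [e' e'e [z Gz zy]] : exists2 e', e' != e & element e' y.
  have ee' : e != e' by rewrite eq_sym.
  have ey : (emap e @` Gam R `&` emap e' @` Gam R) y.
    by split; [exists (edge_par i t)|exists z].
  case: (mesh_conforming ee') => [E|[i0 [j0 [E _]]]|[i0 [j0 [E E']]]].
  - by move: ey; rewrite E.
  - move: ey; rewrite E => /(can_inj (emapK e)).
    by move/(relint_not_vtx t01).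
  - move: ey; rewrite E => -[x i0x /(can_inj (emapK e)) xi].
    rewrite xi in i0x; rewrite -(edge_par_relint t01 i0x).
    by exists e', j0.
apply: contrapT => none.
pose F := \bigcup_(e' in [set e' | e' != e]) element e'.
have cF : closed F.
  apply: closed_bigcup => [|e' _]; first exact: finite_finset.
  exact: closed_element.
have nFy : (~` F) y by move=> [e' e'e e'y]; apply: none; exists e'.
have near_e : \forall z \near y, element e z.
  near=> z.
  have [e' _ e'z] : domain M z by near: z; exact: yint.
  have [<-//|e'e] := eqVneq e' e.
  have nFz : (~` F) z by near: z; apply: open_nbhs_nbhs; split => //; exact: closed_openC.
  by exfalso; apply: nFz; exists e'.
(* An outward normal: its signed cross product with the tangent is the squared length of the
   tangent, which contradicts [Gam_edge_side]. *)
pose nu : R * R := edge_sign i *: ((edge_tangent R i).2, - (edge_tangent R i).1).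
have cg : emap e (edge_par i t + s *: nu) @[s --> (0:R)^'+] --> y.
  apply: cvg_at_right_filter.
  rewrite (_ : (fun s => _) = (fun s : R => y + s *: elin e nu)); last first.
    by apply/funext => s; rewrite (emap_add e (edge_par i t)) elinZ.
  rewrite -[X in _ --> X]addr0 -(scale0r (elin e nu)).
  by apply: cvgD; [exact: cvg_cst|apply: cvgZr_tmp; exact: cvg_id].
have near_g : \forall s \near (0:R)^'+, element e (emap e (edge_par i t + s *: nu)).
  exact: cg near_e.
have [s [s0 [x Gx /(can_inj (emapK e)) xs]]] : exists s : R, 0 < s /\
    element e (emap e (edge_par i t + s *: nu)).
  apply: (@filter_ex _ ((0:R)^'+)); near=> s; split; last by near: s.
  by near: s; exact: nbhs_right_gt.
have := Gam_edge_side i t Gx; rewrite xs [edge_par i t + _]addrC addrK crossZl.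
rewrite (_ : edge_sign i * _ = s * (edge_sign i ^+ 2
    * dot (edge_tangent R i) (edge_tangent R i))); last first.
  by rewrite /nu /cross /dot/= /GRing.scale/=; ring.
rewrite leNgt mulr_gt0// mulr_gt0//.
  by rewrite exprn_even_gt0//= edge_sign_neq0.
rewrite lt_neqAle eq_sym dot_self_eq0 edge_tangent_neq0/=.
by rewrite /dot/= addr_ge0// -expr2 sqr_ge0.
Unshelve. all: by end_near. Qed.

End AffineMeshes.

(** * Piecewise polynomial fields on affine triangulations *)

Section PiecewisePolynomialFields.
Context {R : realType}.
Local Notation mR := (measurableTypeR R).
Local Notation mu := (@lebesgue_measure R).
Local Notation mu2 := (leb2 R).
Variables (M : mesh R) (affM : affine_mesh M) (P Q : elt M -> bipoly R).
Implicit Types (u v w x y z : R * R) (t : R) (i j k : 'I_3) (e : elt M).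

Definition poly_field e x : R * R := (ev (P e) x, ev (Q e) x).

Lemma Rintegral_unit_open (g : R -> R) : continuous g ->
  \int[mu]_(t in `[0, 1]) g t = \int[mu]_(t in `]0, 1[) g t.
Proof.
move=> cg; rewrite /Rintegral; congr fine.
rewrite -integral_itv_obnd_cbnd; last first.
  by apply/measurable_EFinP; apply: measurable_funTS; exact: continuous_measurable_fun.
rewrite -integral_itv_bndo_bndc//.
by apply/measurable_EFinP; apply: measurable_funTS; exact: continuous_measurable_fun.
Qed.

Lemma measurable_restrict_einv e (f : R * R -> R) : continuous f ->
  measurable_fun setT ((((f : mR * mR -> R) \_ Gint) \o einv e) : mR * mR -> R).
Proof.
move=> cf; apply: (@measurableT_comp _ _ _ _ _ _ ((f : mR * mR -> R) \_ Gint)).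
  apply/(measurable_restrictT _ measurable_Gint); apply: measurable_funTS.
  exact: continuous_measurable_fun2.
by apply: measurable_fun_pair; apply: continuous_measurable_fun2 => x;
  have := @continuous_affine2_inv _ (emap e (0, 0)) (elin e (1, 0)) (elin e (0, 1)) x;
  [move=> /(cvg_comp _ _)/(_ cvg_fst)|move=> /(cvg_comp _ _)/(_ cvg_snd)].
Qed.

Lemma emap_substitutes e : substitutes (emap e) `|edet e|.
Proof.
by rewrite (emap_affine2 affM) edetE; apply: substitutes_affine; rewrite -edetE edet_neq0.
Qed.

Lemma restrict_einvK e (f : R * R -> R) :
  (((f : mR * mR -> R) \_ Gint) \o einv e) \o emap e = (f : mR * mR -> R) \_ Gint.
Proof. by apply/funext => x /=; rewrite (emapK affM). Qed.

Lemma integrable_element e (f : R * R -> R) : continuous f ->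
  mu2.-integrable setT (EFin \o (((f : mR * mR -> R) \_ Gint) \o einv e)).
Proof.
move=> cf; apply: (integrable_substitutes (emap_substitutes e)).
  exact: measurable_restrict_einv.
by rewrite restrict_einvK; exact: continuous_Gint_integrable.
Qed.

Lemma Rintegral_element e (f : R * R -> R) : continuous f ->
  \int[mu2]_z (((f : mR * mR -> R) \_ Gint) (einv e z)) =
  `|edet e| * \int[mu2]_z (((f : mR * mR -> R) \_ Gint) z).
Proof.
move=> cf; have <- := Rintegral_substitutes (emap_substitutes e) (measurable_restrict_einv e cf).
  by rewrite -[in RHS](restrict_einvK e).
by rewrite restrict_einvK; exact: continuous_Gint_integrable.
Qed.

Lemma Lfun2_element e (f : R * R -> R) : continuous f ->
  ((((f : mR * mR -> R) \_ Gint) \o einv e) : mR * mR -> R) \in Lfun mu2 2%:E.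
Proof.
move=> cf; apply: integrable_sqr_Lfun2; first exact: measurable_restrict_einv.
have -> : (fun z : mR * mR => ((((f : mR * mR -> R) \_ Gint) \o einv e) z) ^+ 2)
    = (((fun x => f x ^+ 2) : mR * mR -> R) \_ Gint) \o einv e.
  by apply/funext => z /=; rewrite !patchE; case: ifP => // _; rewrite expr0n.
by apply: (@integrable_element e (fun x => f x ^+ 2)) => x; exact: cvgM (cf x) (cf x).
Qed.

Lemma Lfun2_sum_element (f : elt M -> R * R -> R) : (forall e, continuous (f e)) ->
  ((fun z => \sum_e (((f e : mR * mR -> R) \_ Gint) (einv e z))) : mR * mR -> R)
    \in Lfun mu2 2%:E.
Proof.
move=> cf; have l12 : (1 <= 2%:E :> \bar R)%E by rewrite lee_fin ler1n.
have [L0 LD] := @Lfun_addr_closed _ _ R mu2 2%:E l12.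
rewrite (_ : (fun z => _) = \sum_e (((f e : mR * mR -> R) \_ Gint) \o einv e)); last first.
  by apply/funext => z; rewrite fct_sumE.
apply: (big_ind (fun g => g \in Lfun mu2 2%:E)); [exact: L0|exact: LD|].
by move=> e _; exact: Lfun2_element.
Qed.

Lemma einv_domain e z : Gint (einv e z) -> domain M z.
Proof.
move=> G; exists e => //; exists (einv e z); first exact: Gint_Gam.
exact: einvK.
Qed.

(** The summands already vanish outside their elements, so integrals over [domain M] can be taken
    over the plane and split by elements. *)
Lemma restrict_domain (f : elt M -> R * R -> R) :
  (fun z => \sum_e (((f e : mR * mR -> R) \_ Gint) (einv e z))) \_ (domain M) =
  (fun z => \sum_e (((f e : mR * mR -> R) \_ Gint) (einv e z))).
Proof.
apply/funext => z; rewrite patchE; case: ifPn => // /negP nz.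
apply/esym/big1 => e _; rewrite patchE memNset// => /einv_domain Az.
by apply: nz; exact: mem_set.
Qed.

Lemma L2_sum_element (f : elt M -> R * R -> R) : (forall e, continuous (f e)) ->
  L2 (domain M) (fun z => \sum_e (((f e : mR * mR -> R) \_ Gint) (einv e z))).
Proof. by move=> cf; rewrite /L2 restrict_domain; exact: Lfun2_sum_element. Qed.

Lemma Rintegral_sum_element (f : elt M -> R * R -> R) : (forall e, continuous (f e)) ->
  \int[mu2]_z (\sum_e (((f e : mR * mR -> R) \_ Gint) (einv e z))) =
  \sum_e `|edet e| * \int[mu2]_z (((f e : mR * mR -> R) \_ Gint) z).
Proof.
move=> cf; rewrite /Rintegral.
have iE e : mu2.-integrable setT
    (fun z : mR * mR => (((f e : mR * mR -> R) \_ Gint) (einv e z))%:E).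
  exact: integrable_element (cf e).
under eq_integral => z _ do rewrite -sumEFin.
rewrite integral_sum//.
rewrite -sum_fine; last by move=> e _; exact: integrable_fin_num.
by apply: eq_bigr => e _; exact: Rintegral_element.
Qed.

Definition piola_poly e x : R * R := (edet e)^-1 *: elin e (poly_field e x).

(** Off the image of the open triangle both sides are 0; on it ['pinv] agrees with [einv] by
    injectivity, and the differential is constant. *)
Lemma assembledE z :
  \sum_e ((piola (emap e) (poly_field e) \o 'pinv_(fun=> 0) (Gam R) (emap e))
       \_ (emap e @` (Gam R)^°)) z =
  (\sum_e (((fst \o piola_poly e : mR * mR -> R) \_ Gint) (einv e z)),
   \sum_e (((snd \o piola_poly e : mR * mR -> R) \_ Gint) (einv e z))).
Proof.
have E e : ((piola (emap e) (poly_field e) \o 'pinv_(fun=> 0) (Gam R) (emap e))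
       \_ (emap e @` (Gam R)^°)) z =
    ((((fst \o piola_poly e : mR * mR -> R) \_ Gint) (einv e z)),
     (((snd \o piola_poly e : mR * mR -> R) \_ Gint) (einv e z))).
  rewrite GintE !patchE.
  have [Gz|nGz] := pselect (Gint (einv e z)).
    have Ez : (emap e @` Gint) z by exists (einv e z) => //; exact: einvK.
    rewrite !mem_set//=.
    have GGz := Gint_Gam Gz.
    have -> : 'pinv_(fun=> 0) (Gam R) (emap e) z = einv e z.
      rewrite -[in LHS](einvK affM e z) pinvKV ?inE//.
      by move=> x y _ _ /(can_inj (emapK affM e)).
    rewrite /piola /piola_poly (jac_detE affM e GGz) (emap_diffE affM e _ GGz).
    exact: surjective_pairing.
  rewrite !memNset//.
  by move=> [x Gx xz]; apply: nGz; rewrite -xz (emapK affM).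
under eq_bigr do rewrite E.
rewrite [LHS]surjective_pairing; congr pair.
  by rewrite (big_morph fst (id1 := 0) (op1 := +%R)).
by rewrite (big_morph snd (id1 := 0) (op1 := +%R)).
Qed.

Lemma continuous_elin e (f : R * R -> R * R) :
  continuous (fst \o f) -> continuous (snd \o f) ->
  continuous (fst \o (fun x => elin e (f x))) /\ continuous (snd \o (fun x => elin e (f x))).
Proof.
move=> c1 c2; split=> x.
- rewrite (_ : fst \o _ = fun x => (f x).1 * (elin e (1, 0)).1 + (f x).2 * (elin e (0, 1)).1).
    by apply: cvgD; apply: cvgM; [exact: c1|exact: cvg_cst|exact: c2|exact: cvg_cst].
  by apply/funext => y /=; rewrite elinE.
- rewrite (_ : snd \o _ = fun x => (f x).1 * (elin e (1, 0)).2 + (f x).2 * (elin e (0, 1)).2).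
    by apply: cvgD; apply: cvgM; [exact: c1|exact: cvg_cst|exact: c2|exact: cvg_cst].
  by apply/funext => y /=; rewrite elinE.
Qed.

Lemma continuous_piola_poly e :
  continuous (fst \o piola_poly e) /\ continuous (snd \o piola_poly e).
Proof.
have [c1 c2] := @continuous_elin e (poly_field e) (@continuous_ev _ (P e)) (@continuous_ev _ (Q e)).
split=> x; rewrite /piola_poly.
  by apply: (@cvgM _ _ _ _ (fun=> (edet e)^-1)); [exact: cvg_cst|exact: c1].
by apply: (@cvgM _ _ _ _ (fun=> (edet e)^-1)); [exact: cvg_cst|exact: c2].
Qed.

(** Piola identity: this is the divergence, at the point [emap e x], of the mapped field. *)
Definition poly_div e x : R := (edet e)^-1 * (ev (dxi (P e)) x + ev (deta (Q e)) x).

Lemma continuous_poly_div e : continuous (poly_div e).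
Proof.
move=> x; apply: cvgM; first exact: cvg_cst.
by apply: cvgD; exact: continuous_ev.
Qed.

(** * Edge fluxes weighted by a test function *)

Section TestFunction.
Variables (psi : R * R -> R) (smooth_psi : smooth psi).

Lemma smooth_differentiable z : differentiable psi z.
Proof. exact: (smooth_psi [::]). Qed.

Lemma continuous_smooth : continuous psi.
Proof. by move=> z; exact: differentiable_continuous (smooth_differentiable z). Qed.

Lemma continuous_smooth_D v : continuous ('D_v psi).
Proof. by move=> z; exact: differentiable_continuous (smooth_psi [:: v] z). Qed.

Lemma diff_grad z v : 'd psi z v = dot v (grad psi z).
Proof.
by rewrite diff_pairE /grad /dot/= !deriveE//; exact: smooth_differentiable.
Qed.

Lemma is_derive_emap_x e (x y : R) :
  is_derive x 1 (fun x' : R => psi (emap e (x', y)))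
    (dot (elin e (1, 0)) (grad psi (emap e (x, y)))).
Proof.
have L s : emap e (s, y) = emap e (0, y) + s *: elin e (1, 0).
  rewrite -elinZ -(emap_add affM); congr (emap e _).
  by congr pair; rewrite /= /GRing.scale/=; ring.
have := @is_derive_line _ _ psi (emap e (0, y)) (elin e (1, 0)) x.
rewrite diff_grad -L => /(_ (smooth_differentiable _)).
by congr (is_derive _ _ _ _); apply/funext => s; rewrite L.
Qed.

Lemma is_derive_emap_y e (x y : R) :
  is_derive y 1 (fun y' : R => psi (emap e (x, y')))
    (dot (elin e (0, 1)) (grad psi (emap e (x, y)))).
Proof.
have L s : emap e (x, s) = emap e (x, 0) + s *: elin e (0, 1).
  rewrite -elinZ -(emap_add affM); congr (emap e _).
  by congr pair; rewrite /= /GRing.scale/=; ring.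
have := @is_derive_line _ _ psi (emap e (x, 0)) (elin e (0, 1)) y.
rewrite diff_grad -L => /(_ (smooth_differentiable _)).
by congr (is_derive _ _ _ _); apply/funext => s; rewrite L.
Qed.

Lemma is_derive_ev_x (n : bipoly R) (x y : R) :
  is_derive x 1 (fun x' : R => ev n (x', y)) (ev (dxi n) (x, y)).
Proof.
have := is_derive_ev n (0, y) (1, 0) x.
have L (s : R) : (0, y) + s *: (1, 0) = (s, y) :> R * R.
  by congr pair; rewrite /= /GRing.scale/=; ring.
rewrite L mul1r mul0r addr0.
by congr (is_derive _ _ _ _); apply/funext => s; rewrite L.
Qed.

Lemma is_derive_ev_y (n : bipoly R) (x y : R) :
  is_derive y 1 (fun y' : R => ev n (x, y')) (ev (deta n) (x, y)).
Proof.
have := is_derive_ev n (x, 0) (0, 1) y.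
have L (s : R) : (x, 0) + s *: (0, 1) = (x, s) :> R * R.
  by congr pair; rewrite /= /GRing.scale/=; ring.
rewrite L mul1r mul0r add0r.
by congr (is_derive _ _ _ _); apply/funext => s; rewrite L.
Qed.

Lemma continuous_emap e : continuous (emap e).
Proof. by rewrite (emap_affine2 affM e); exact: continuous_affine2. Qed.

Lemma continuous_psi_emap e : continuous (psi \o emap e).
Proof.
by move=> x; apply: continuous_comp; [exact: continuous_emap|exact: continuous_smooth].
Qed.

Lemma continuous_D_emap e v : continuous ('D_v psi \o emap e).
Proof.
by move=> x; apply: continuous_comp; [exact: continuous_emap|exact: continuous_smooth_D].
Qed.

Lemma continuous_dot_grad e (f : R * R -> R * R) :
  continuous (fst \o f) -> continuous (snd \o f) ->
  continuous (fun x => dot (f x) (grad psi (emap e x))).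
Proof.
move=> c1 c2 x; apply: cvgD.
  by apply: cvgM; [exact: c1|exact: (@continuous_D_emap e (1, 0))].
by apply: cvgM; [exact: c2|exact: (@continuous_D_emap e (0, 1))].
Qed.

(* The divergence theorem on one element, pulled back to the reference triangle. *)
Lemma element_divergence e :
  `|edet e| * \int[mu2]_z (((fun x => dot (piola_poly e x) (grad psi (emap e x))
      + poly_div e x * psi (emap e x)) : mR * mR -> R) \_ Gint) z
  = \sum_i (`|edet e| / edet e * edge_sign i) *
    \int[mu]_(t in `[0, 1]) (psi (emap e (edge_par i t))
      * cross (poly_field e (edge_par i t)) (edge_tangent R i)).
Proof.
(* The reference field times the pulled-back test function. By the chain rule its divergence
   [D1 + D2] is [edet e] times the integrand. *)
pose F1 x := psi (emap e x) * ev (P e) x.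
pose F2 x := psi (emap e x) * ev (Q e) x.
pose D1 x := psi (emap e x) * ev (dxi (P e)) x
  + ev (P e) x * dot (elin e (1, 0)) (grad psi (emap e x)).
pose D2 x := psi (emap e x) * ev (deta (Q e)) x
  + ev (Q e) x * dot (elin e (0, 1)) (grad psi (emap e x)).
have cF1 : continuous F1.
  by move=> x; apply: cvgM; [exact: continuous_psi_emap|exact: continuous_ev].
have cF2 : continuous F2.
  by move=> x; apply: cvgM; [exact: continuous_psi_emap|exact: continuous_ev].
have cD1 : continuous D1.
  move=> x; apply: cvgD; apply: cvgM; try exact: continuous_ev.
    exact: continuous_psi_emap.
  by apply: (@continuous_dot_grad e (fun=> _)) => z; exact: cvg_cst.
have cD2 : continuous D2.
  move=> x; apply: cvgD; apply: cvgM; try exact: continuous_ev.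
    exact: continuous_psi_emap.
  by apply: (@continuous_dot_grad e (fun=> _)) => z; exact: cvg_cst.
have dF1 (x y : R) : is_derive x 1 (fun x' : R => F1 (x', y)) (D1 (x, y)).
  exact: (@is_deriveM _ _ (fun x' : R => psi (emap e (x', y))) (fun x' : R => ev (P e) (x', y))
    x 1 _ _ (is_derive_emap_x e x y) (is_derive_ev_x (P e) x y)).
have dF2 (x y : R) : is_derive y 1 (fun y' : R => F2 (x, y')) (D2 (x, y)).
  exact: (@is_deriveM _ _ (fun y' : R => psi (emap e (x, y'))) (fun y' : R => ev (Q e) (x, y'))
    y 1 _ _ (is_derive_emap_y e x y) (is_derive_ev_y (Q e) x y)).
have iDD : mu2.-integrable setT
    (EFin \o (((fun x => D1 x + D2 x) : mR * mR -> R) \_ Gint)).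
  by apply: continuous_Gint_integrable => x; apply: cvgD; [exact: cD1|exact: cD2].
have -> : ((fun x => dot (piola_poly e x) (grad psi (emap e x))
      + poly_div e x * psi (emap e x)) : mR * mR -> R) \_ Gint
    = (fun z => (edet e)^-1 * (((fun x => D1 x + D2 x) : mR * mR -> R) \_ Gint) z).
  apply/funext => z; rewrite !patchE; case: ifP => [_|_]; last by rewrite mulr0.
  rewrite /piola_poly elinE /D1 /D2 /poly_div /poly_field /dot/=.
  case: (elin e (1, 0)) => b1 b2; case: (elin e (0, 1)) => c1 c2 /=.
  by rewrite /GRing.scale/=; ring.
rewrite RintegralZl// (Rintegral_Gint_div cF1 cF2 cD1 cD2 dF1 dF2).
rewrite mulrA mulr_sumr; apply: eq_bigr => i _; rewrite mulrA; congr (_ * _).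
by apply: eq_Rintegral => t _; rewrite /F1 /F2 /cross/=; ring.
Qed.

Hypothesis normal_trace : forall e i e' j t, interface e i e' j -> t \in `[0, 1] ->
  cross (poly_field e (edge_par i t)) (edge_tangent R i)
  = cross (poly_field e' (edge_par j t)) (edge_tangent R j).
Hypothesis supp_psi : closure [set x | psi x != 0] `<=` (domain M)^°.

(** The sign of the determinant is what remains of the substitution factor [|edet e|] and the Piola
    factor [(edet e)^-1]; [edge_sign] makes the reference flux outward. *)
Definition edge_flux (q : elt M * 'I_3) : R :=
  (`|edet q.1| / edet q.1 * edge_sign q.2) *
    \int[mu]_(t in `[0, 1]) (psi (emap q.1 (edge_par q.2 t))
      * cross (poly_field q.1 (edge_par q.2 t)) (edge_tangent R q.2)).

Lemma edge_flux_interface e i e' j : interface e i e' j ->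
  edge_flux (e', j) = - edge_flux (e, i).
Proof.
move=> int; rewrite /edge_flux/= -mulNr; congr (_ * _).
  exact: opposite_signs (edge_signP _) (edge_signP _) (edet_neq0 e) (edet_neq0 e')
    (interface_orientation affM int).
apply: eq_Rintegral => t /set_mem t01.
by rewrite (interface_point int t01) (normal_trace int t01).
Qed.

Lemma continuous_edge_integrand e i :
  continuous (fun t => psi (emap e (edge_par i t))
      * cross (poly_field e (edge_par i t)) (edge_tangent R i)).
Proof.
have cpar : continuous (@edge_par R i).
  move=> t; apply: cvgD; first exact: cvg_cst.
  by apply: cvgZr_tmp; exact: cvg_id.
have cev (n : bipoly R) : continuous (ev n \o edge_par i).
  by move=> t; apply: continuous_comp; [exact: cpar|exact: continuous_ev].
move=> t; apply: cvgM.
  apply: (@continuous_comp _ _ _ (edge_par i) (psi \o emap e)); first exact: cpar.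
  exact: continuous_psi_emap.
by apply: cvgB; apply: cvgM; try exact: cvg_cst; exact: cev.
Qed.

Lemma edge_flux_boundary e i : (forall e' j, ~ interface e i e' j) ->
  edge_flux (e, i) = 0.
Proof.
(* The end points are removed because a vertex of a boundary edge is out of reach of
   [interior_edge_interface]. *)
move=> none; rewrite /edge_flux/= Rintegral_unit_open; last exact: continuous_edge_integrand.
rewrite (_ : \int[mu]_(t in _) _ = \int[mu]_(t in `]0%R, 1%R[) 0); last first.
  apply: eq_Rintegral => t /set_mem; rewrite /= in_itv/= => t01.
  have -> : psi (emap e (edge_par i t)) = 0; last by rewrite mul0r.
  apply/eqP/negPn/negP => psi0.
  have /supp_psi/(interior_edge_interface affM t01)[e' [j int]] :
      closure [set x | psi x != 0] (emap e (edge_par i t)) by exact: subset_closure.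
  exact: none int.
by rewrite Rintegral_cst// mul0r mulr0.
Qed.

(* Every edge either carries no flux or is paired with the one other edge at its
   interface, with the opposite flux. *)
Lemma sum_edge_flux : \sum_e \sum_i edge_flux (e, i) = 0.
Proof.
rewrite (pair_big xpredT xpredT (fun e i => edge_flux (e, i)))/=.
(* An edge without neighbour is its own partner; its flux is 0, so taking partners negates the flux
   there as well. *)
pose partner (q : elt M * 'I_3) := if pselect (exists q', interface q.1 q.2 q'.1 q'.2)
  is left ex then projT1 (cid ex) else q.
have partnerP q q' : interface q.1 q.2 q'.1 q'.2 -> partner q = q'.
  rewrite /partner => int; case: pselect => [ex|[]]; last by exists q'.
  case: cid => r /= int'; have := interface_unique affM int' int.
  by rewrite -!surjective_pairing.
have flux q : edge_flux (partner q) = - edge_flux q.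
  have [[q' int]|nex] := pselect (exists q', interface q.1 q.2 q'.1 q'.2).
    rewrite (partnerP _ _ int) (surjective_pairing q) (surjective_pairing q').
    exact: edge_flux_interface.
  have -> : partner q = q by rewrite /partner; case: pselect.
  rewrite (surjective_pairing q) edge_flux_boundary ?oppr0// => e' j int.
  by apply: nex; exists (e', j).
have partnerK : involutive partner.
  move=> q; have [[q' int]|nex] := pselect (exists q', interface q.1 q.2 q'.1 q'.2).
    rewrite (partnerP _ _ int); apply: partnerP; exact: interface_sym.
  have -> : partner q = q by rewrite /partner; case: pselect.
  by rewrite /partner; case: pselect.
(* Reindexing the sum by the involution [partner] negates every term. *)
set S := (X in X = 0); suff : S = - S by lra.
rewrite {1}/S (reindex_inj (inv_inj partnerK))/= -sumrN.
by apply: eq_bigr => -[e i] _; rewrite -(surjective_pairing (partner _)) flux.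
Qed.

End TestFunction.

(** The weak divergence is the elementwise one. Pulled back to the reference triangle, the two sides
    of the weak identity differ by the sum of all edge fluxes. *)
Lemma poly_field_Hdiv :
  (forall e i e' j t, interface e i e' j -> t \in `[0, 1] ->
    cross (poly_field e (edge_par i t)) (edge_tangent R i)
    = cross (poly_field e' (edge_par j t)) (edge_tangent R j)) ->
  Hdiv (domain M) (fun z => \sum_e
    ((piola (emap e) (poly_field e) \o 'pinv_(fun=> 0) (Gam R) (emap e))
       \_ (emap e @` (Gam R)^°)) z).
Proof.
move=> trace; have -> := funext assembledE.
have cp e := continuous_piola_poly e.
split.
- exact: (@L2_sum_element (fun e => fst \o piola_poly e) (fun e => (cp e).1)).
- exact: (@L2_sum_element (fun e => snd \o piola_poly e) (fun e => (cp e).2)).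
exists (fun z => \sum_e (((poly_div e : mR * mR -> R) \_ Gint) (einv e z))).
  exact: L2_sum_element continuous_poly_div.
move=> psi [spsi _ supp].
pose a e x := dot (piola_poly e x) (grad psi (emap e x)).
pose b e x := poly_div e x * psi (emap e x).
have ca e : continuous (a e).
  by have [c1 c2] := cp e; exact: (continuous_dot_grad spsi).
have cb e : continuous (b e).
  by move=> x; apply: cvgM; [exact: continuous_poly_div|exact: (continuous_psi_emap spsi)].
rewrite [LHS]Rintegral_mkcond [in RHS]Rintegral_mkcond.
have -> : (fun z => dot (\sum_e (((fst \o piola_poly e : mR * mR -> R) \_ Gint) (einv e z)),
   \sum_e (((snd \o piola_poly e : mR * mR -> R) \_ Gint) (einv e z))) (grad psi z)) \_ (domain M)
   = (fun z => \sum_e (((a e : mR * mR -> R) \_ Gint) (einv e z))).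
  rewrite -restrict_domain; congr (_ \_ _); apply/funext => z.
  rewrite /dot/= !mulr_suml -big_split/=; apply: eq_bigr => e _.
  rewrite !patchE; case: ifP => _; last by rewrite !mul0r addr0.
  by rewrite /a /dot/= einvK.
have -> : (fun z => (\sum_e (((poly_div e : mR * mR -> R) \_ Gint) (einv e z))) * psi z)
    \_ (domain M) = (fun z => \sum_e (((b e : mR * mR -> R) \_ Gint) (einv e z))).
  rewrite -restrict_domain; congr (_ \_ _); apply/funext => z.
  rewrite mulr_suml; apply: eq_bigr => e _.
  rewrite !patchE; case: ifP => _; last by rewrite !mul0r.
  by rewrite /b einvK.
rewrite !Rintegral_sum_element//.
apply/eqP; rewrite -subr_eq0 opprK -big_split/=; apply/eqP.
rewrite -[RHS](sum_edge_flux spsi trace supp); apply: eq_bigr => e _.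
rewrite -mulrDr -RintegralD//; try exact: continuous_Gint_integrable.
rewrite /edge_flux/= -element_divergence//; congr (_ * _).
apply: eq_Rintegral => z _; rewrite !patchE /a /b; case: ifP => // _; exact: addr0.
Qed.

End PiecewisePolynomialFields.

(** * Polynomial form of the shape functions *)

Section PolynomialShapeFunctions.
Context {R : realType}.
Implicit Types (phi : R * R -> R * R) (n : bipoly R) (x : R * R).

(** Explicit polynomial components give continuity on the whole plane and the formal derivatives
    from which the weak divergence is built. *)
Definition polynomial_field phi : Prop :=
  exists P Q : bipoly R, forall x, phi x = (ev P x, ev Q x).

Lemma polynomial_field0 : polynomial_field (fun=> 0).
Proof. by exists 0, 0 => x; rewrite /ev !horner0. Qed.

Lemma polynomial_fieldD phi1 phi2 : polynomial_field phi1 -> polynomial_field phi2 ->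
  polynomial_field (fun x => phi1 x + phi2 x).
Proof.
by move=> [P1 [Q1 E1]] [P2 [Q2 E2]]; exists (P1 + P2), (Q1 + Q2) => x; rewrite E1 E2 !evD.
Qed.

Lemma polynomial_field_tensor n phi : polynomial_field phi ->
  polynomial_field (fun x => ev n x *: phi x).
Proof. by move=> [P [Q E]]; exists (n * P), (n * Q) => x; rewrite E !evM. Qed.

Lemma polynomial_fieldZ (c : R) phi : polynomial_field phi ->
  polynomial_field (fun x => c *: phi x).
Proof.
move=> /(polynomial_field_tensor c%:P%:P); congr polynomial_field.
by apply/funext => x; rewrite /ev !hornerC.
Qed.

Lemma polynomial_field_sum (I : finType) (F : I -> R * R -> R * R) :
  (forall i, polynomial_field (F i)) -> polynomial_field (fun x => \sum_i F i x).
Proof.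
move=> hF; elim: (index_enum I) => [|i r IH].
  by under eq_fun do rewrite big_nil; exact: polynomial_field0.
by under eq_fun do rewrite big_cons; exact: polynomial_fieldD.
Qed.

Lemma polynomial_field_Rgrad n : polynomial_field (Rgrad n).
Proof. by exists (deta n), (- dxi n) => x; rewrite evN. Qed.

Lemma polynomial_field_phi :
  [/\ polynomial_field (@phi1 R), polynomial_field (@phi2 R) & polynomial_field (@phi3 R)].
Proof.
have evX x : ev 'X%:P x = x.1 by rewrite /ev !hornerE.
have evY x : ev 'X x = x.2 by rewrite /ev !hornerE.
have ev1 x : ev 1 x = 1 :> R by rewrite /ev !hornerE.
split.
- by exists (1 - 'X%:P), (- 'X) => x; rewrite evD !evN ev1 evX evY.
- by exists 'X%:P, ('X - 1) => x; rewrite evD !evN ev1 evX evY.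
- by exists (- 'X%:P), (- 'X) => x; rewrite !evN evX evY.
Qed.

Lemma polynomial_field_v_comb (F : vector_fe R) ce cc :
  (forall j k, polynomial_field (vedgef (v := F) j k)) ->
  (forall k, polynomial_field (vcellf (v := F) k)) -> polynomial_field (v_comb (F := F) ce cc).
Proof.
move=> he hc; apply: polynomial_fieldD; apply: polynomial_field_sum => j.
  by apply: polynomial_field_sum => k; exact: polynomial_fieldZ.
exact: polynomial_fieldZ.
Qed.

Lemma polynomial_field_RT (p : nat) (U : h1_family R p) (W : h1_family R p.+1) ce cc :
  polynomial_field (v_comb (F := RT U W) ce cc).
Proof.
have [h1 h2 h3] := polynomial_field_phi.
have N phi : polynomial_field phi -> polynomial_field (- phi).
  by move=> /(polynomial_fieldZ (-1)); congr polynomial_field;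
    apply/funext => x; rewrite scaleN1r.
have B phi psi : polynomial_field phi -> polynomial_field psi ->
    polynomial_field (phi - psi).
  by move=> hp /N; exact: polynomial_fieldD.
apply: polynomial_field_v_comb => [j [k|]|[k|[k|[[j k]|k]]]] /=.
- exact: polynomial_field_Rgrad.
- by move: j; apply: ord3_cases; rewrite /phiI (tnth_nth (@phi1 R)).
- exact: polynomial_field_Rgrad.
- apply: polynomial_field_tensor; case: k => [[|[|//]] ltk];
  by rewrite /T_vert (tnth_nth (@phi1 R))/=; first [exact: N|exact: h2].
- apply: polynomial_field_tensor; move: j; apply: ord3_cases;
  by rewrite /T_edge (tnth_nth (@phi1 R))/=; apply: (B) => //; exact: N.
- by apply: polynomial_field_tensor; apply: (B) => //; exact: B.
Qed.

End PolynomialShapeFunctions.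

Theorem theorem3p8 (R : realType) (p : nat) (hp : (1 <= p)%N)
    (U : h1_family R p) (W : h1_family R p.+1)
    (hU : h1_conforming_basis U) (hW : h1_conforming_basis W) :
  Hdiv_conforming (RT U W).
Proof.
have [_ Upoly _] := hU; have [_ Wpoly Wcont] := hW.
move=> M ce cc cec; split; first exact: RT_no_normal_jump.
move=> affM.
have /choice[PQ PQE] e : exists PQ : bipoly R * bipoly R,
    v_comb (F := RT U W) (ce e) (cc e) = (fun x => (ev PQ.1 x, ev PQ.2 x)).
  have [P [Q PQE]] := polynomial_field_RT (ce e) (cc e).
  by exists (P, Q); apply/funext.
have -> : v_assembled ce cc = fun z => \sum_e
    ((piola (emap e) (poly_field (fst \o PQ) (snd \o PQ) e)
       \o 'pinv_(fun=> 0) (Gam R) (emap e)) \_ (emap e @` (Gam R)^°)) z.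
  by apply/funext => z; apply: eq_bigr => e _; rewrite PQE.
apply: poly_field_Hdiv => // e i e' j t int t01.
have := v_comb_trace_interface Upoly Wpoly cc Wcont cec int t01.
by rewrite !PQE.
Qed.
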